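(* Let $q>0$ be an even integer. Let $\widetilde{\mathsf{Uni}}_{\mathrm{Serre}}(q/2,q/2)$ (for $q\equiv 0 \bmod 4$) be the set of isomorphism classes of Serre unicycles of signature $(q/2,q/2)$, and let $\widetilde{\mathsf{Bi}}_{\mathrm{Serre}}(q/2,q/2)$ (for $q\equiv 2\bmod 4$) be the set of isomorphism classes of Serre bicycles of signature $(q/2,q/2)$, where isomorphisms are isomorphisms of unitary $\mathrm{BT}_1$ modules. Then $$\#\widetilde{\mathsf{Uni}}_{\mathrm{Serre}}(q/2,q/2) = \frac{1}{q}\sum_{d\mid q,\ d\text{ odd}}\mu(d)\, 2^{q/2d} \qquad\text{when } q\equiv 0 \bmod 4,$$ $$\#\widetilde{\mathsf{Bi}}_{\mathrm{Serre}}(q/2,q/2) = \frac{1}{q}\sum_{d\,\mid\, q/2}\mu(d)\, 2^{q/2d} \qquad\text{when } q\equiv 2 \bmod 4.$$ Here $d$ runs over positive divisors, $\mu$ is the Möbius function, and $q/2d$ means $q/(2d)$.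
   Context: $k$ is an algebraically closed field of prime characteristic $p>2$. A word is a nonempty finite string $w=u_{\ell-1}\cdots u_0$ in $\{\mathtt f,\mathtt v\}$, of length $\ell(w)=\ell$; $w$ is primitive if it is not a concatenation of $n>1$ copies of a shorter word; $w^\star$ is obtained by exchanging $\mathtt f$ and $\mathtt v$; $\tau(u_{\ell-1}\cdots u_0)=u_0u_{\ell-1}\cdots u_1$; $w$ is self-dual if $w^\star=\tau^n(w)$ for some $n$. A unitary $\mathrm{BT}_1$ module is $(M,F,V,\lambda,M=M_0\oplus M_1)$ with $M$ a finite-dimensional $k$-vector space, $F$ Frobenius-linear, $V$ inverse-Frobenius-linear, $\ker F=\operatorname{im}V$, $\ker V=\operatorname{im}F$, $\lambda$ a symplectic form on $M$ with $\lambda(F(x),y)=\lambda(x,V(y))^p$, $F,V$ mapping $M_i$ into $M_{1-i}$, and $M_0,M_1$ Lagrangian. Its signature is $(\dim_k\ker(F|_{M_1}),\dim_k\ker(F|_{M_0}))$. Isomorphisms are $k$-linear isomorphisms respecting all the structure. For a word $w=u_{\ell-1}\cdots u_0$, $\overline M(w)$ has $k$-basis $a_0,\dots,a_{\ell-1}$ (indices mod $\ell$) with $F(a_j)=a_{j+1}$ if $u_j=\mathtt f$ and $0$ if $u_j=\mathtt v$; $V(a_{j+1})=a_j$ if $u_j=\mathtt v$ and $0$ if $u_j=\mathtt f$. For $w$ of even length, $\widetilde M(w,w^\star)$ is $\overline M(w)\oplus\overline M(w^\star)$ (standard bases $a_j$ and $b_j$) with symplectic form determined by $\lambda(a_i,b_j)=\delta_{i,j}$,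 $\lambda(a_i,a_j)=\lambda(b_i,b_j)=0$, with $M_0$ spanned by the $a_j$ ($j$ even) and $b_j$ ($j$ odd), and $M_1$ spanned by the $a_j$ ($j$ odd) and $b_j$ ($j$ even). It is a Serre unicycle if $w$ is primitive, self-dual and $4\mid\ell(w)$; it is a Serre bicycle if $w=zz$ with $z$ primitive of odd length. *)

(* Defs.v *)
From HB Require Import structures.
From mathcomp Require Import all_boot all_order all_algebra.
From mathcomp Require Import sesquilinear.
From mathcomp Require Import ring.
From mathcomp Require Import boolp classical_sets.

Set Implicit Arguments.
Unset Strict Implicit.
Unset Printing Implicit Defensive.

Import GRing.Theory.
Local Open Scope ring_scope.

(* A letter is a boolean, [true] standing for f and [false] for v. A word
   u_(l-1) ... u_0 is stored from right to left, so that its [i]-th entry (from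
   0) is the letter u_i; then tau is [rot 1]. Nonemptiness is part of
   [primitive_word]. *)
Definition word := seq bool.

Definition word_star (w : word) : word := map negb w.

Definition primitive_word (w : word) : Prop :=
  w != [::] /\
  ~ (exists (z : word) (n : nat), (1 < n)%N /\ w = flatten (nseq n z)).

Definition self_dual_word (w : word) : Prop :=
  exists n : nat, word_star w = iter n (rot 1) w.

(* The inverse-Frobenius-linearity V (a^(1/p) x) = a^(1/p) V x is stated without
   p-th roots. Over a field of characteristic p > 2 the library's
   [is_psymplectic] means skew-symmetric (equivalently alternating) and
   nondegenerate. A subspace is Lagrangian if it is its own orthogonal. *)
Record unitaryBT1 (k : fieldType) (p : nat) := UnitaryBT1 {
  bt_space :> vectType k;
  bt_F : bt_space -> bt_space;
  bt_V : bt_space -> bt_space;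
  bt_form : {skew_symmetric bt_space};
  bt_M0 : {vspace bt_space};
  bt_M1 : {vspace bt_space};
  bt_FD : forall x y, bt_F (x + y) = bt_F x + bt_F y;
  bt_FZ : forall a x, bt_F (a *: x) = a ^+ p *: bt_F x;
  bt_VD : forall x y, bt_V (x + y) = bt_V x + bt_V y;
  bt_VZ : forall a x, bt_V (a ^+ p *: x) = a *: bt_V x;
  bt_kerF : forall x, bt_F x = 0 <-> exists y, x = bt_V y;
  bt_kerV : forall x, bt_V x = 0 <-> exists y, x = bt_F y;
  bt_symplectic : is_psymplectic bt_form;
  bt_formFV : forall x y, bt_form (bt_F x) y = bt_form x (bt_V y) ^+ p;
  bt_sum : (bt_M0 + bt_M1)%VS = fullv;
  bt_direct : (bt_M0 :&: bt_M1)%VS = 0%VS;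
  bt_F0 : forall x, x \in bt_M0 -> bt_F x \in bt_M1;
  bt_F1 : forall x, x \in bt_M1 -> bt_F x \in bt_M0;
  bt_V0 : forall x, x \in bt_M0 -> bt_V x \in bt_M1;
  bt_V1 : forall x, x \in bt_M1 -> bt_V x \in bt_M0;
  bt_lagrangian0 : orthov bt_form bt_M0 = bt_M0;
  bt_lagrangian1 : orthov bt_form bt_M1 = bt_M1
}.

Definition bt_isomorphic (k : fieldType) (p : nat) (M N : unitaryBT1 k p) : Prop :=
  exists g : {linear M -> N},
    [/\ bijective g,
        (forall x, g (bt_F x) = bt_F (g x)) /\ (forall x, g (bt_V x) = bt_V (g x)),
        forall x y, bt_form N (g x) (g y) = bt_form M x y,
        forall x, (g x \in bt_M0 N) = (x \in bt_M0 M)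
      & forall x, (g x \in bt_M1 N) = (x \in bt_M1 M)].

(* [F] is only semilinear, so the library's [lker] does not apply to it. *)
Definition ker_dim (k : fieldType) (p : nat) (M : unitaryBT1 k p)
    (U : {vspace M}) (n : nat) : Prop :=
  exists K : {vspace M},
    (forall x, x \in K <-> x \in U /\ bt_F x = 0) /\ \dim K = n.

Definition has_signature (k : fieldType) (p : nat) (M : unitaryBT1 k p)
    (s : nat * nat) : Prop :=
  ker_dim (bt_M1 M) s.1 /\ ker_dim (bt_M0 M) s.2.

Section StandardModule.
Variables (k : closedFieldType) (p : nat).
Hypothesis (pchark : p \in [pchar k]).

Definition proot (a : k) : k := xget 0 [set b | b ^+ p = a]%classic.

Let p_gt0 : (0 < p)%N.
Proof. by apply: prime_gt0; case/andP: pchark. Qed.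

Lemma prootK a : proot a ^+ p = a.
Proof.
rewrite /proot; case: xgetP => [b _ // | no].
have : size ('X^p - a%:P) != 1%N by rewrite size_XnsubC // eqSS -lt0n.
move/closed_rootP => [x]; rewrite rootE !hornerE subr_eq0 => /eqP xa.
by case: (no x).
Qed.

Lemma pfrobD (a b : k) : (a + b) ^+ p = a ^+ p + b ^+ p.
Proof. exact: (pFrobenius_autD_comm pchark (mulrC a b)). Qed.

Lemma pfrobB (a b : k) : (a - b) ^+ p = a ^+ p - b ^+ p.
Proof. exact: (pFrobenius_autB_comm pchark (mulrC a b)). Qed.

Lemma pfrob_sum (I : finType) (f : I -> k) :
  (\sum_i f i) ^+ p = \sum_i f i ^+ p.
Proof.
by elim/big_ind2: _ => [|x a y b <- <-|//]; rewrite ?pfrobD ?expr0n // eqn0Ngt p_gt0.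
Qed.

Lemma pfrob_eq0 (a : k) : a ^+ p = 0 -> a = 0.
Proof. by move=> /eqP; rewrite expf_eq0 p_gt0 => /eqP. Qed.

Lemma pfrob_inj : injective (fun a : k => a ^+ p).
Proof.
by move=> a b /= ab; apply/subr0_eq/pfrob_eq0; rewrite pfrobB ab subrr.
Qed.

Lemma expKproot a : proot (a ^+ p) = a.
Proof. by apply: pfrob_inj; rewrite /= prootK. Qed.

Lemma proot0 : proot 0 = 0.
Proof. by apply: pfrob_eq0; rewrite prootK. Qed.

Lemma proot1 : proot 1 = 1.
Proof. by apply: pfrob_inj; rewrite /= prootK expr1n. Qed.

Lemma prootD a b : proot (a + b) = proot a + proot b.
Proof. by apply: pfrob_inj; rewrite /= pfrobD !prootK. Qed.

Lemma prootZ a b : proot (a ^+ p * b) = a * proot b.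
Proof. by apply: pfrob_inj; rewrite /= exprMn !prootK. Qed.

Lemma proot_eq0 a : proot a = 0 -> a = 0.
Proof. by move=> a0; rewrite -(prootK a) a0 expr0n eqn0Ngt p_gt0. Qed.

Section Word.
Variables (w : word) (l : nat).
Local Notation rV := 'rV[k]_l.

(* The semilinear extensions of F(a_j) = a_(j+1) or 0 and V(a_(j+1)) = a_j or 0
   to coordinate vectors; see [stdF_delta] and [stdV_delta]. *)
Definition stdF (x : rV) : rV :=
  \row_i (if nth false w (ord_pred i) then x ord0 (ord_pred i) ^+ p else 0).

Definition stdV (x : rV) : rV :=
  \row_i (if nth false w i then 0 else proot (x ord0 (ordS i))).

Lemma stdF_delta (j : 'I_l) :
  stdF (delta_mx ord0 j) =
  if nth false w j then delta_mx ord0 (ordS j) else 0.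
Proof.
apply/rowP => i; rewrite !mxE eqxx (can2_eq (@ord_predK l) (@ordSK l)) andTb.
have [->|ij] := eqVneq i (ordS j).
  by rewrite ordSK; case: ifP; rewrite !mxE ?eqxx ?expr1n.
have -> : (if nth false w j then delta_mx ord0 (ordS j) else 0 : rV) ord0 i = 0.
  by case: ifP; rewrite !mxE ?(negPf ij) ?andbF.
by case: ifP; rewrite // expr0n eqn0Ngt p_gt0.
Qed.

Lemma stdV_delta (j : 'I_l) :
  stdV (delta_mx ord0 (ordS j)) =
  if nth false w j then 0 else delta_mx ord0 j.
Proof.
apply/rowP => i; rewrite !mxE eqxx (inj_eq (@ordS_inj l)) andTb.
have [->|ij] := eqVneq i j.
  by case: ifP; rewrite !mxE ?eqxx ?proot1.
have -> : (if nth false w j then 0 else delta_mx ord0 j : rV) ord0 i = 0.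
  by case: ifP; rewrite !mxE ?(negPf ij) ?andbF.
by rewrite proot0; case: ifP.
Qed.

Lemma stdFD x y : stdF (x + y) = stdF x + stdF y.
Proof. by apply/rowP => i; rewrite !mxE; case: ifP; rewrite ?pfrobD ?addr0. Qed.

Lemma stdFZ a x : stdF (a *: x) = a ^+ p *: stdF x.
Proof. by apply/rowP => i; rewrite !mxE; case: ifP; rewrite ?exprMn ?mulr0. Qed.

Lemma stdVD x y : stdV (x + y) = stdV x + stdV y.
Proof. by apply/rowP => i; rewrite !mxE; case: ifP; rewrite ?prootD ?addr0. Qed.

Lemma stdVZ a x : stdV (a ^+ p *: x) = a *: stdV x.
Proof. by apply/rowP => i; rewrite !mxE; case: ifP; rewrite ?prootZ ?mulr0. Qed.

Lemma std_kerF x : stdF x = 0 <-> exists y, x = stdV y.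
Proof.
split=> [/rowP Fx0 | [y ->]]; last first.
  apply/rowP => i; rewrite !mxE; case: (nth _ _ _) => //.
  by rewrite expr0n eqn0Ngt p_gt0.
exists (\row_i x ord0 (ord_pred i) ^+ p); apply/rowP => i.
rewrite !mxE ordSK expKproot; case: ifP => // wi.
by have := Fx0 (ordS i); rewrite !mxE ordSK wi => /pfrob_eq0.
Qed.

Lemma std_kerV x : stdV x = 0 <-> exists y, x = stdF y.
Proof.
split=> [/rowP Vx0 | [y ->]]; last first.
  by apply/rowP => i; rewrite !mxE ordSK; case: (nth _ _ _); rewrite ?proot0.
exists (\row_i proot (x ord0 (ordS i))); apply/rowP => i.
rewrite !mxE ord_predK prootK; case: ifP => // wi.
by have := Vx0 (ord_pred i); rewrite !mxE ord_predK wi => /proot_eq0.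
Qed.

End Word.

End StandardModule.

Section StandardForm.
Variables (k : fieldType) (l : nat).
Local Notation VV := ('rV[k]_l * 'rV[k]_l)%type.

Definition std_a (j : 'I_l) : VV := (delta_mx ord0 j, 0).
Definition std_b (j : 'I_l) : VV := (0, delta_mx ord0 j).

Definition stdform (x y : VV) : k :=
  \sum_i (x.1 ord0 i * y.2 ord0 i - x.2 ord0 i * y.1 ord0 i).

Lemma stdform_bilinear : bilinear_for *%R (idfun \; *%R) stdform.
Proof.
split=> [y a x x'|x a y y'] /=; rewrite /stdform mulr_sumr -big_split /=;
  by apply: eq_bigr => i _; rewrite !mxE; ring.
Qed.

HB.instance Definition _ :=
  bilinear_isBilinear.Build k VV VV k *%R (idfun \; *%R) stdform
    stdform_bilinear.

Lemma stdform_skew x y : stdform x y = (-1) ^+ true * idfun (stdform y x).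
Proof.
rewrite expr1 mulN1r /= /stdform -sumrN; apply: eq_bigr => i _.
by ring.
Qed.

HB.instance Definition _ :=
  isHermitianSesquilinear.Build k VV true idfun stdform stdform_skew.

Lemma stdform_ar i y : stdform (std_a i) y = y.2 ord0 i.
Proof.
rewrite /stdform (bigD1 i) //= big1 ?addr0 => [|j ji]; rewrite !mxE ?eqxx.
  by rewrite mul1r mul0r subr0.
by rewrite (negPf ji) !mul0r subr0.
Qed.

Lemma stdform_br i y : stdform (std_b i) y = - y.1 ord0 i.
Proof.
rewrite /stdform (bigD1 i) //= big1 ?addr0 => [|j ji]; rewrite !mxE ?eqxx.
  by rewrite mul1r mul0r sub0r.
by rewrite (negPf ji) !mul0r subr0.
Qed.

Lemma stdform_ab i j : stdform (std_a i) (std_b j) = (i == j)%:R.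
Proof. by rewrite stdform_ar mxE eqxx. Qed.

Lemma stdform_aa i j : stdform (std_a i) (std_a j) = 0.
Proof. by rewrite stdform_ar mxE. Qed.

Lemma stdform_bb i j : stdform (std_b i) (std_b j) = 0.
Proof. by rewrite stdform_br mxE oppr0. Qed.

Lemma stdform_psymplectic : is_psymplectic (stdform : {skew_symmetric VV}).
Proof.
split=> //; last first.
  by move=> _ u; rewrite /= /stdform big1 // => i _; rewrite mulrC subrr.
apply/eqP/vspaceP => x; rewrite memv0; apply/mem_orthovP/eqP => [x0|-> v _]; last first.
  by rewrite linear0l.
have x1 i : x.1 ord0 i = 0.
  have := x0 (std_b i) (memvf _).
  by rewrite hermC /= stdform_br expr1 mulN1r opprK.
have x2 i : x.2 ord0 i = 0.
  have /eqP := x0 (std_a i) (memvf _).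
  by rewrite hermC /= stdform_ar expr1 mulN1r oppr_eq0 => /eqP.
case: x x1 x2 {x0} => y z /= y0 z0; congr pair; apply/rowP => i.
  by rewrite y0 mxE.
by rewrite z0 mxE.
Qed.

(* The span of the a_j with j = c mod 2 and the b_j with j <> c mod 2: M_0 for
   [c = false], M_1 for [c = true]. *)
Definition std_part (c : bool) : {vspace VV} :=
  (\sum_(j < l | odd j == c) <[std_a j]> +
   \sum_(j < l | odd j != c) <[std_b j]>)%VS.

Lemma mem_std_part c x :
  x \in std_part c <->
  forall j : 'I_l, if odd j == c then x.2 ord0 j = 0 else x.1 ord0 j = 0.
Proof.
have pr1 (I : finType) (P : pred I) (f : I -> VV) j :
    (\sum_(i | P i) f i).1 ord0 j = \sum_(i | P i) (f i).1 ord0 j.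
  by rewrite (raddf_sum fst) summxE.
have pr2 (I : finType) (P : pred I) (f : I -> VV) j :
    (\sum_(i | P i) f i).2 ord0 j = \sum_(i | P i) (f i).2 ord0 j.
  by rewrite (raddf_sum snd) summxE.
split=> [/memv_addP[u /memv_sumP[u_ u_P ->] [v /memv_sumP[v_ v_P ->] ->]] j|x0].
  rewrite /= !mxE pr1 pr2; case: ifP => jc; rewrite ?pr1 ?pr2.
    rewrite !big1 ?addr0 // => i ic.
      have /vlineP[a ->] := v_P i ic; rewrite !mxE eqxx /=.
      by have [ji|_] := eqVneq j i; [rewrite -ji jc in ic | rewrite mulr0].
    by have /vlineP[a ->] := u_P i ic; rewrite !mxE mulr0.
  rewrite !big1 ?addr0 // => i ic.
    by have /vlineP[a ->] := v_P i ic; rewrite !mxE mulr0.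
  have /vlineP[a ->] := u_P i ic; rewrite !mxE eqxx /=.
  by have [ji|_] := eqVneq j i; [rewrite -ji jc in ic | rewrite mulr0].
have -> : x = \sum_(j < l | odd j == c) x.1 ord0 j *: std_a j +
              \sum_(j < l | odd j != c) x.2 ord0 j *: std_b j.
  apply/eqP; rewrite -[_ == _]/((_ == _) && (_ == _)).
  apply/andP; split; apply/eqP/rowP => j; have := x0 j; rewrite /= !mxE.
    rewrite !pr1 [X in _ + X]big1 => [|i _]; last by rewrite !mxE mulr0.
    rewrite addr0; case: ifP => jc xj.
      rewrite (bigD1 j) //= big1 => [|i /andP[_ ij]]; rewrite !mxE.
        by rewrite eqxx eqxx mulr1 addr0.
      by rewrite [j == i]eq_sym (negPf ij) andbF mulr0.
    rewrite xj big1 // => i; have [->|ij _] := eqVneq i j; first by rewrite jc.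
    by rewrite !mxE [j == i]eq_sym (negPf ij) andbF mulr0.
  rewrite !pr2 [X in X + _]big1 => [|i _]; last by rewrite !mxE mulr0.
  rewrite add0r; case: ifP => jc xj.
    rewrite xj big1 // => i; have [->|ij _] := eqVneq i j; first by rewrite jc.
    by rewrite !mxE [j == i]eq_sym (negPf ij) andbF mulr0.
  rewrite (bigD1 j) ?jc //= big1 => [|i /andP[_ ij]]; rewrite !mxE.
    by rewrite eqxx eqxx mulr1 addr0.
  by rewrite [j == i]eq_sym (negPf ij) andbF mulr0.
apply: memv_add; apply: memv_suml => j jc; apply: memvZ.
  by apply: subvP (memv_line _); rewrite (sumv_sup j).
by apply: subvP (memv_line _); rewrite (sumv_sup j).
Qed.

Lemma std_part_sum : (std_part false + std_part true)%VS = fullv.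
Proof.
apply/eqP; rewrite eqEsubv subvf /=; apply/subvP => x _.
pose y c : VV := (\row_j (if odd j == c then x.1 ord0 j else 0),
                  \row_j (if odd j == c then 0 else x.2 ord0 j)).
have -> : x = y false + y true.
  apply/eqP; rewrite -[_ == _]/((_ == _) && (_ == _)).
  apply/andP; split; apply/eqP/rowP => j; rewrite !mxE;
    by case: (odd j); rewrite ?addr0 ?add0r.
by apply: memv_add; apply/mem_std_part => j; case: ifP; rewrite /= !mxE => ->.
Qed.

Lemma std_part_cap : (std_part false :&: std_part true)%VS = 0%VS.
Proof.
apply/eqP; rewrite -subv0; apply/subvP => x /memv_capP[/mem_std_part x0 /mem_std_part x1].
rewrite memv0 -[_ == _]/((_ == _) && (_ == _)).
by apply/andP; split; apply/eqP/rowP => j; rewrite mxE;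
   have := x0 j; have := x1 j; case: (odd j).
Qed.

Lemma std_part_lagrangian c :
  orthov (stdform : {skew_symmetric VV}) (std_part c) = std_part c.
Proof.
apply/vspaceP => x; apply/mem_orthovP/idP => [xP|/mem_std_part x0 y /mem_std_part y0].
  apply/mem_std_part => j; case: ifP => jc.
    have ajP : std_a j \in std_part c.
      by apply/mem_std_part => i; case: ifP => ic; rewrite !mxE //=;
        have [ij|//] := eqVneq i j; rewrite ij jc in ic.
    have := xP _ ajP; rewrite hermC /= stdform_ar expr1 mulN1r.
    by move/eqP; rewrite oppr_eq0 => /eqP.
  have bjP : std_b j \in std_part c.
    by apply/mem_std_part => i; case: ifP => ic; rewrite !mxE //=;
      have [ij|//] := eqVneq i j; rewrite ij jc in ic.
  by have := xP _ bjP; rewrite hermC /= stdform_br expr1 mulN1r opprK.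
rewrite /= /stdform big1 // => j _; have := x0 j; have := y0 j.
by case: ifP => _ -> ->; rewrite ?(mul0r, mulr0) subrr.
Qed.

End StandardForm.

Section StandardUnitary.
Variables (k : closedFieldType) (p : nat).
Hypothesis (pchark : p \in [pchar k]).
Variable (w : word).
Local Notation l := (size w).
Local Notation VV := ('rV[k]_l * 'rV[k]_l)%type.

(* The direct sum of the modules of w and of its dual, words of equal length. *)
Definition tildeF (x : VV) : VV := (stdF p w x.1, stdF p (word_star w) x.2).
Definition tildeV (x : VV) : VV := (stdV p w x.1, stdV p (word_star w) x.2).

Lemma nth_word_star (i : 'I_l) : nth false (word_star w) i = ~~ nth false w i.
Proof. by rewrite (nth_map false). Qed.

Lemma tildeFD x y : tildeF (x + y) = tildeF x + tildeF y.
Proof. by rewrite /tildeF !(stdFD pchark). Qed.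

Lemma tildeFZ a x : tildeF (a *: x) = a ^+ p *: tildeF x.
Proof. by rewrite /tildeF !stdFZ. Qed.

Lemma tildeVD x y : tildeV (x + y) = tildeV x + tildeV y.
Proof. by rewrite /tildeV !(stdVD pchark). Qed.

Lemma tildeVZ a x : tildeV (a ^+ p *: x) = a *: tildeV x.
Proof. by rewrite /tildeV !(stdVZ pchark). Qed.

Lemma tilde_kerF x : tildeF x = 0 <-> exists y, x = tildeV y.
Proof.
split=> [[/(std_kerF pchark)[y1 xy1] /(std_kerF pchark)[y2 xy2]]|[y ->]].
  by exists (y1, y2); rewrite /tildeV -xy1 -xy2 -surjective_pairing.
congr pair; apply/(std_kerF pchark); first by exists y.1.
by exists y.2.
Qed.

Lemma tilde_kerV x : tildeV x = 0 <-> exists y, x = tildeF y.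
Proof.
split=> [[/(std_kerV pchark)[y1 xy1] /(std_kerV pchark)[y2 xy2]]|[y ->]].
  by exists (y1, y2); rewrite /tildeF -xy1 -xy2 -surjective_pairing.
congr pair; apply/(std_kerV pchark); first by exists y.1.
by exists y.2.
Qed.

Lemma tilde_formFV x y :
  stdform (tildeF x) y = stdform x (tildeV y) ^+ p.
Proof.
rewrite /stdform (pfrob_sum pchark) (reindex_inj (@ordS_inj l)).
apply: eq_bigr => i _; rewrite (pfrobB pchark) !exprMn !mxE !ordSK nth_word_star.
have p0 : (0 : k) ^+ p = 0 by rewrite -[RHS](rmorph0 (pFrobenius_aut pchark)).
by case: (nth _ _ _); rewrite /= ?(prootK pchark) p0 !(mul0r, mulr0).
Qed.

Hypothesis w_even : ~~ odd (size w).

Lemma odd_ordS (i : 'I_l) : odd (ordS i) = ~~ odd i.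
Proof.
rewrite /=; have := ltn_ord i; rewrite leq_eqVlt => /orP[/eqP il|il].
  by rewrite il modnn; have := w_even; rewrite -{1}il oddS negbK => ->.
by rewrite modn_small.
Qed.

Lemma odd_ord_pred (i : 'I_l) : odd (ord_pred i) = ~~ odd i.
Proof. by rewrite -{2}[i]ord_predK odd_ordS negbK. Qed.

Lemma tildeF_part c x : x \in std_part k l c -> tildeF x \in std_part k l (~~ c).
Proof.
have p0 : (0 : k) ^+ p = 0 by rewrite -[RHS](rmorph0 (pFrobenius_aut pchark)).
move=> /mem_std_part x0; apply/mem_std_part => j; have := x0 (ord_pred j).
by rewrite !mxE odd_ord_pred eqb_negLR; case: ifP => _ ->; rewrite p0; case: ifP.
Qed.

Lemma tildeV_part c x : x \in std_part k l c -> tildeV x \in std_part k l (~~ c).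
Proof.
move=> /mem_std_part x0; apply/mem_std_part => j; have := x0 (ordS j).
by rewrite !mxE odd_ordS eqb_negLR; case: ifP => _ ->;
  rewrite (proot0 pchark); case: ifP.
Qed.

Definition tildeM : unitaryBT1 k p := {|
  bt_space := VV;
  bt_F := tildeF;
  bt_V := tildeV;
  bt_form := @stdform k l;
  bt_M0 := std_part k l false;
  bt_M1 := std_part k l true;
  bt_FD := tildeFD;
  bt_FZ := tildeFZ;
  bt_VD := tildeVD;
  bt_VZ := tildeVZ;
  bt_kerF := tilde_kerF;
  bt_kerV := tilde_kerV;
  bt_symplectic := @stdform_psymplectic k l;
  bt_formFV := tilde_formFV;
  bt_sum := std_part_sum k l;
  bt_direct := std_part_cap k l;
  bt_F0 := @tildeF_part false;
  bt_F1 := @tildeF_part true;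
  bt_V0 := @tildeV_part false;
  bt_V1 := @tildeV_part true;
  bt_lagrangian0 := std_part_lagrangian k l false;
  bt_lagrangian1 := std_part_lagrangian k l true
|}.

End StandardUnitary.

Definition serre_unicycle (k : closedFieldType) (p : nat) (pchark : p \in [pchar k])
    (M : unitaryBT1 k p) : Prop :=
  exists (w : word) (w_even : ~~ odd (size w)),
    [/\ primitive_word w, self_dual_word w, (4 %| size w)%N
      & bt_isomorphic M (tildeM pchark w_even)].

Definition serre_bicycle (k : closedFieldType) (p : nat) (pchark : p \in [pchar k])
    (M : unitaryBT1 k p) : Prop :=
  exists (w : word) (w_even : ~~ odd (size w)),
    (exists z : word, [/\ w = z ++ z, primitive_word z & odd (size z)]) /\
    bt_isomorphic M (tildeM pchark w_even).

(* Isomorphism classes are predicates on [unitaryBT1 k p]. That type is too large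
   for the [set] of MathComp-Analysis and its cardinality relation, whence
   [has_card]. *)
Definition iso_class (k : fieldType) (p : nat) (M : unitaryBT1 k p) :
    unitaryBT1 k p -> Prop :=
  fun N => bt_isomorphic M N.

Definition Uni_Serre (k : closedFieldType) (p : nat) (pchark : p \in [pchar k])
    (s : nat * nat) : (unitaryBT1 k p -> Prop) -> Prop :=
  fun C => exists M : unitaryBT1 k p,
    [/\ serre_unicycle pchark M, has_signature M s & C = iso_class M].

Definition Bi_Serre (k : closedFieldType) (p : nat) (pchark : p \in [pchar k])
    (s : nat * nat) : (unitaryBT1 k p -> Prop) -> Prop :=
  fun C => exists M : unitaryBT1 k p,
    [/\ serre_bicycle pchark M, has_signature M s & C = iso_class M].

Definition has_card (T : Type) (A : T -> Prop) (n : nat) : Prop :=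
  exists f : 'I_n -> T,
    (forall i j, f i = f j -> i = j) /\ (forall x, A x <-> exists i, f i = x).

Definition mobius (n : nat) : int :=
  if all (fun r => logn r n == 1%N) (primes n) then (-1) ^+ size (primes n) else 0.

(* Main.v *)
(** Write M(w) for the unitary module attached to a word w of even length, and w'
    for the dual word. The shift a_j |-> a_(j+1) and the exchange of the two
    summands identify M(w) with M(tau w) and with M(w'), each up to swapping the
    Lagrangian parts M_0 and M_1. An odd number of these moves fixes w: for a
    unicycle, the rotation by half the length (an even number) followed by
    duality; for a bicycle w = zz, the rotation by the length of z. Hence M(w) is
    isomorphic to itself with M_0 and M_1 swapped, so that its signature is
    balanced and all rotations of w and of w' give isomorphic modules.

    Conversely, F and V determine the words: follow the letters of a word s from
    a vector x, applying F for f and passing to a V-preimage for v. In M(w) the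
    coordinates evolve independently, and there is an x from which s can be
    followed, but never to 0, exactly if s is read off cyclically from w or w'.

    The classes are thus the rotation orbits of w, or for bicycles those of z up
    to duality. They all have q elements, and the words of full period are counted
    by Moebius inversion over the divisors of the length. *)
From HB Require Import structures.
Require Import Defs.
From mathcomp Require Import all_boot all_order all_algebra.
From mathcomp Require Import sesquilinear boolp.
From mathcomp Require Import zify ring.

Set Implicit Arguments.
Unset Strict Implicit.
Unset Printing Implicit Defensive.

Import GRing.Theory.
Local Open Scope ring_scope.

(** * Moebius inversion *)

(** If r divides d, its exponent in [r * d] is at least 2. Otherwise [r * d] has just one prime
    factor more than d, of exponent 1. *)
Lemma mobiusMp (r d : nat) : prime r -> (0 < d)%N ->
  mobius (r * d) = if (r %| d)%N then 0 else - mobius d.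
Proof.
move=> r_pr d_gt0; have r_gt0 := prime_gt0 r_pr.
case: ifP => [rd | /negbT rNd].
  rewrite /mobius ifN //; apply/allPn; exists r.
    by rewrite primesM // primes_prime // inE eqxx.
  rewrite lognM // logn_prime // eqxx.
  have : (0 < logn r d)%N by rewrite logn_gt0 mem_primes r_pr d_gt0.
  by case: (logn r d).
have rd0 : logn r d = 0%N.
  by apply/eqP; rewrite -leqn0 leqNgt logn_gt0 mem_primes r_pr d_gt0.
have pM : perm_eq (primes (r * d)) (r :: primes d).
  apply: uniq_perm; rewrite ?primes_uniq //= ?primes_uniq ?andbT //.
    by rewrite mem_primes r_pr d_gt0.
  by move=> s; rewrite primesM // primes_prime // !inE.
rewrite /mobius (perm_all _ pM) (perm_size pM) /= lognM // logn_prime // eqxx rd0 /=.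
rewrite (@eq_in_all _ _ (fun s => logn s d == 1%N)); last first.
  move=> s s_d /=; rewrite lognM // logn_prime //.
  suff /negPf-> : s != r by [].
  by apply: contraTneq s_d => ->; rewrite mem_primes r_pr d_gt0.
by case: ifP; rewrite ?oppr0 // exprS mulN1r.
Qed.

(* A prime r dividing n pairs each divisor d prime to r with r * d. *)
Lemma sum_mobius_divisors (n : nat) : (0 < n)%N ->
  \sum_(d <- divisors n) mobius d = (n == 1)%:R.
Proof.
move=> n_gt0; have [->|n1] := eqVneq n 1%N; first by rewrite big_seq1.
have [r r_pr rn] : exists2 r, prime r & (r %| n)%N.
  by exists (pdiv n); rewrite ?pdiv_dvd ?pdiv_prime // ltn_neqAle eq_sym n1.
have r_gt0 := prime_gt0 r_pr.
have nr_gt0 : (0 < n %/ r)%N by rewrite divn_gt0 // dvdn_leq.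
rewrite (bigID (fun d => r %| d)%N) /= -big_filter.
have pr : perm_eq [seq d <- divisors n | (r %| d)%N]
                  [seq (r * d)%N | d <- divisors (n %/ r)].
  apply: uniq_perm; rewrite ?filter_uniq ?divisors_uniq //.
    rewrite map_inj_uniq ?divisors_uniq // => a b /eqP.
    by rewrite eqn_pmul2l // => /eqP.
  move=> d; rewrite mem_filter -dvdn_divisors //.
  apply/andP/mapP => [[rd dn]|[e]]; last first.
    by rewrite -dvdn_divisors // dvdn_divRL // mulnC => en ->; rewrite dvdn_mulr.
  exists (d %/ r)%N; last by rewrite mulnC divnK.
  by rewrite -dvdn_divisors // dvdn_divRL // divnK.
rewrite (perm_big _ pr) big_map /= (bigID (fun d => r %| d)%N) /= big_seq_cond.
rewrite big1 ?add0r => [|d /andP[]]; last first.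
  by rewrite -dvdn_divisors // => /(dvdn_gt0 nr_gt0) d_gt0 rd; rewrite mobiusMp // rd.
rewrite big_seq_cond (eq_bigr (fun d => - mobius d)) => [|d /andP[]]; last first.
  rewrite -dvdn_divisors // => /(dvdn_gt0 nr_gt0) d_gt0 /negPf rd.
  by rewrite mobiusMp // rd.
rewrite -big_seq_cond sumrN -!(big_filter (divisors _)).
(* What remains are the divisors prime to r of n and of n / r, with opposite signs; by Gauss the two
   sets coincide. *)
rewrite (perm_big [seq d <- divisors n | ~~ (r %| d)%N]) /= ?addNr //.
apply: uniq_perm; rewrite ?filter_uniq ?divisors_uniq // => d.
rewrite !mem_filter -!dvdn_divisors //.
case: (boolP (r %| d)%N) => //= rNd.
rewrite -{2}(divnK rn) Gauss_dvdl // coprime_sym prime_coprime //.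
Qed.

(** * Periods of words *)

Section Period.
Variables (T : finType) (f : T -> T).
Hypothesis f_inj : injective f.

(** The first [order f x] iterates of x are distinct and then repeat, so only the remainder of i
    modulo the order counts. *)
Lemma iter_id_order (i : nat) (x : T) : (iter i f x == x) = (order f x %| i)%N.
Proof.
have iterMid k : iter (k * order f x) f x = x.
  by elim: k => // k IH; rewrite mulSn iterD IH iter_order.
rewrite {1}(divn_eq i (order f x)) addnC iterD iterMid /dvdn.
have r_lt : (i %% order f x < order f x)%N by rewrite ltn_mod order_gt0.
have <- : nth x (orbit f x) (i %% order f x) = iter (i %% order f x) f x.
  by rewrite nth_traject.
have /eqP x0 : nth x (orbit f x) 0 == x by rewrite nth_traject ?order_gt0.
by rewrite -[X in _ == X]x0 nth_uniq ?size_traject ?order_gt0 ?orbit_uniq.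
Qed.

(** After exchanging the sums, a point of order e contributes the sum of [mobius d] over the
    divisors d of n / e, which is 1 if e = n and 0 otherwise. *)
Lemma sum_mobius_period (n : nat) (B : {set T}) : (0 < n)%N ->
  {in B, forall x, iter n f x = x} ->
  (#|[set x in B | order f x == n]|%:Z =
   \sum_(d <- divisors n) mobius d * #|[set x in B | iter (n %/ d) f x == x]|%:Z)%R.
Proof.
move=> n_gt0 B_n.
have cardE (P : pred T) : (#|[set x in B | P x]|%:Z = \sum_(x in B) (P x)%:R)%R.
  rewrite -natz -sum1_card natr_sum big_mkcond [RHS]big_mkcond.
  by apply: eq_bigr => x _; rewrite inE; case: (x \in B); case: (P x).
under [RHS]eq_bigr => d _ do rewrite cardE mulr_sumr.
rewrite cardE exchange_big; apply: eq_bigr => x xB /=.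
have en : (order f x %| n)%N by rewrite -iter_id_order B_n.
have e_gt0 : (0 < order f x)%N := order_gt0 f x.
have ne_gt0 : (0 < n %/ order f x)%N by rewrite divn_gt0 // dvdn_leq.
transitivity (\sum_(d <- divisors n | (order f x %| n %/ d)%N) mobius d); last first.
  rewrite big_mkcond; apply: eq_bigr => d _.
  by rewrite iter_id_order; case: ifP; rewrite ?mulr1 ?mulr0.
rewrite -big_filter (perm_big (divisors (n %/ order f x))); last first.
  apply: uniq_perm; rewrite ?filter_uniq ?divisors_uniq // => d.
  rewrite mem_filter -!dvdn_divisors // [RHS]dvdn_divRL // andbC.
  apply/andP/idP => [[dn]|den].
    by rewrite dvdn_divRL // mulnC.
  have dn : (d %| n)%N by apply: dvdn_trans den; rewrite dvdn_mulr.
  by rewrite dn dvdn_divRL // mulnC.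
rewrite sum_mobius_divisors //; congr (_ %:R); congr nat_of_bool.
apply/eqP/eqP => [<-|ne]; first by rewrite divnn e_gt0.
by rewrite -(divnK en) ne mul1n.
Qed.
End Period.

(** * Rotations of words *)

Lemma nth_iter_rot (T : Type) (x0 : T) (s : seq T) (i j : nat) : (j < size s)%N ->
  nth x0 (iter i (rot 1) s) j = nth x0 s ((j + i) %% size s).
Proof.
have nth_rot1 t k : (k < size t)%N ->
    nth x0 (rot 1 t) k = nth x0 t (k.+1 %% size t).
  case: t => // a t /=; rewrite rot1_cons nth_rcons ltnS leq_eqVlt.
  case/orP=> [/eqP->|kt]; first by rewrite ltnn eqxx modnn.
  by rewrite kt modn_small.
have sz k : size (iter k (rot 1) s) = size s by elim: k => //= k IH; rewrite size_rot.
elim: i j => [|i IH] j js; first by rewrite addn0 modn_small.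
have s_gt0 : (0 < size s)%N by apply: leq_ltn_trans js.
by rewrite iterS nth_rot1 sz // IH ?ltn_mod // modnDml addSnnS.
Qed.

Lemma size_iter_rot (T : Type) (s : seq T) (i : nat) :
  size (iter i (rot 1) s) = size s.
Proof. by elim: i => //= i IH; rewrite size_rot. Qed.

Lemma map_iter_rot (T U : Type) (g : T -> U) (s : seq T) (i : nat) :
  map g (iter i (rot 1) s) = iter i (rot 1) (map g s).
Proof. by elim: i => //= i <-; rewrite map_rot. Qed.

Lemma iter_rot_size (T : Type) (s : seq T) : iter (size s) (rot 1) s = s.
Proof.
case E: s => [//|x0 s']; rewrite -E; apply: (@eq_from_nth _ x0).
  by rewrite size_iter_rot.
move=> j; rewrite size_iter_rot => js.
by rewrite nth_iter_rot // modnDr modn_small.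
Qed.

Lemma iter_rot_cat (T : Type) (s : seq T) (i : nat) :
  iter i (rot 1) (s ++ s) = iter i (rot 1) s ++ iter i (rot 1) s.
Proof.
elim: i => //= i ->; case: (iter i _ s) => // x t.
by rewrite cat_cons !rot1_cons -!cats1 -!catA.
Qed.

(* Such a word is determined by its first h letters: letter i + h is letter i,
   negated when [c] holds. *)
Lemma card_antiperiodic (n h D : nat) (c : bool) :
  n = (h * D)%N -> (0 < h)%N -> (0 < D)%N -> c && odd D = false ->
  #|[set w : n.-tuple bool | iter h (rot 1) w == map (addb c) w]| = (2 ^ h)%N.
Proof.
move=> nE h_gt0 D_gt0 cD.
pose gen (z : seq bool) j := nth false z (j %% h) (+) (c && odd (j %/ h)).
pose F (z : h.-tuple bool) : n.-tuple bool := [tuple gen z i | i < n].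
have hn : (h <= n)%N by rewrite nE leq_pmulr.
have nthF z j : (j < n)%N -> nth false (F z) j = gen z j.
  by move=> jn; rewrite -[j]/(nat_of_ord (Ordinal jn)) -tnth_nth tnth_mktuple.
have F_inj : injective F.
  move=> z z' /(congr1 val) zz'; apply/val_inj/(@eq_from_nth _ false).
    by rewrite !size_tuple.
  move=> j; rewrite size_tuple => jh; have jn := leq_trans jh hn.
  have := congr1 (nth false ^~ j) zz'; rewrite /= !nthF // /gen.
  by rewrite modn_small // divn_small // andbF !addbF.
rewrite -[RHS](_ : #|[set: h.-tuple bool]| = _); last by rewrite cardsT card_tuple card_bool.
rewrite -(card_imset _ F_inj); congr #|pred_of_set _|; apply/setP => w; rewrite inE.
have n_gt0 : (0 < n)%N by apply: leq_trans hn.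
apply/eqP/imsetP => [wP|[z _ ->]]; last first.
  apply: (@eq_from_nth _ false); first by rewrite size_iter_rot size_map.
  move=> j; rewrite size_iter_rot => js; rewrite nth_iter_rot // (nth_map false) //.
  have jn : (j < n)%N by rewrite -(size_tuple (F z)).
  rewrite size_tuple.
  rewrite !nthF ?ltn_mod // /gen.
  have -> : ((j + h) %% n %% h = j %% h)%N.
    by rewrite {1}nE modn_dvdm ?dvdn_mulr // modnDr.
  rewrite addbCA; congr (_ (+) _).
  (* Either the block number j / h grows by 1, or it wraps from D - 1 to 0. In the second case the
     signs match because D is even whenever c holds. *)
  have [jhn|njh] := ltnP (j + h)%N n.
    rewrite modn_small // divnDr // divnn h_gt0 oddD /=.
    by case: (c); case: (odd _).
  have -> : ((j + h) %% n = j + h - n)%N.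
    by rewrite -{1}(subnK njh) modnDr modn_small //; lia.
  have : (D + (j + h - n) %/ h = 1 + j %/ h)%N.
    rewrite -!divnMDl // mulnC -nE mul1n; congr (_ %/ _)%N; lia.
  move/(congr1 odd); rewrite !oddD /=.
  by move: cD; case: (c); case: (odd D); case: (odd (j %/ h)); case: (odd _).
have step j : (j + h < n)%N -> nth false w (j + h) = c (+) nth false w j.
  move=> jhn; have jn : (j < size w)%N by rewrite size_tuple; lia.
  have := congr1 (nth false ^~ j) wP; rewrite nth_iter_rot //.
  by rewrite (nth_map false) // size_tuple modn_small.
exists [tuple nth false w i | i < h] => //.
apply/val_inj/(@eq_from_nth _ false); first by rewrite !size_tuple.
move=> j; rewrite size_tuple => jn; rewrite nthF // /gen.
have jh : (j %% h < h)%N by rewrite ltn_mod.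
rewrite -[(j %% h)%N]/(nat_of_ord (Ordinal jh)) -tnth_nth tnth_mktuple /=.
rewrite {1}(divn_eq j h).
have : (j %/ h < D)%N by rewrite ltn_divLR // mulnC -nE.
elim: (j %/ h)%N => [|a IH] aD; first by rewrite mul0n add0n andbF addbF.
have ahn : (a * h + j %% h + h < n)%N by rewrite nE; nia.
have -> : (a.+1 * h + j %% h = a * h + j %% h + h)%N by rewrite mulSn; lia.
rewrite step // IH ?(ltnW aD) //=.
by case: (c); case: (nth _ _ _); case: (odd a).
Qed.

(** A word t at least as long as z and commuting with it starts with z; what is left after removing
    this copy still commutes with z. *)
Lemma rot_commute_flatten (T : Type) (z t : seq T) (k : nat) :
  z ++ t = t ++ z -> size t = (k * size z)%N -> t = flatten (nseq k z).
Proof.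
elim: k t => [|k IH] t zt szt; first by move/size0nil: szt => ->.
have zE : take (size z) t = z.
  have := congr1 (take (size z)) zt.
  by rewrite take_size_cat // takel_cat // szt leq_pmull.
have {zE} tE : t = z ++ drop (size z) t by rewrite -{1}(cat_take_drop (size z) t) zE.
rewrite tE /=; congr (_ ++ _); apply: IH.
  move: zt; rewrite {1}tE [in RHS]tE -!catA => /(congr1 (drop (size z))).
  by rewrite !drop_size_cat // => <-.
by rewrite size_drop szt mulSn addKn.
Qed.

(** * Primitive and self-dual words *)

Section Words.
Variable n : nat.
Implicit Types w x y : n.-tuple bool.

(** Tuples form a finite type, on which [order] and [fconnect] give periods and rotation orbits. *)
Definition rotT w : n.-tuple bool := [tuple of rot 1 w].
Definition starT w : n.-tuple bool := [tuple of map negb w].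

Lemma val_iter_rotT i w : iter i rotT w = iter i (rot 1) w :> word.
Proof. by elim: i => //= i <-. Qed.

Lemma rotT_inj : injective rotT.
Proof. by move=> x y /(congr1 val) /rot_inj /val_inj. Qed.

Lemma starTK : involutive starT.
Proof. by move=> w; apply/val_inj; rewrite /= -map_comp map_id_in //= => b; rewrite negbK. Qed.

Lemma starT_iter i w : starT (iter i rotT w) = iter i rotT (starT w).
Proof. by apply/val_inj; rewrite /= !val_iter_rotT map_iter_rot. Qed.

Lemma iter_rotT_n w : iter n rotT w = w.
Proof. by apply/val_inj; rewrite /= val_iter_rotT -{1}(size_tuple w) iter_rot_size. Qed.

Lemma starT_neq w : (0 < n)%N -> starT w != w.
Proof.
move=> n_gt0; apply/eqP => /(congr1 (fun w' : n.-tuple bool => nth false w' 0)) /=.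
by rewrite (nth_map false) ?size_tuple //; case: (nth _ _ _).
Qed.

Lemma order_dvdn w : (order rotT w %| n)%N.
Proof. by rewrite -(iter_id_order rotT_inj) iter_rotT_n. Qed.

(** A proper power of z has the period [size z] < n. Conversely, a word of order e < n is a power of
    its prefix of length e, which commutes with the rest. *)
Lemma primitive_wordE w : (0 < n)%N -> primitive_word w <-> order rotT w = n.
Proof.
move=> n_gt0; split=> [[_ w_prim]|wn]; last first.
  split=> [|[z [k [k1 wE]]]].
    by apply: contraTneq n_gt0 => w0; rewrite -(size_tuple w) w0.
  have nE : n = (k * size z)%N.
    rewrite -(size_tuple w) wE size_flatten /shape map_nseq sumn_nseq mulnC //.
  have : (order rotT w %| size z)%N.
    rewrite -(iter_id_order rotT_inj); apply/eqP/val_inj; rewrite /= val_iter_rotT.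
    rewrite wE; case: k {wE nE} k1 => // k _.
    have iter_rot s1 s2 : iter (size s1) (rot 1) (s1 ++ s2) = s2 ++ s1 :> word.
      elim: s1 s2 => [|a s1 IH] s2; first by rewrite cats0.
      by rewrite iterSr cat_cons rot1_cons rcons_cat IH cat_rcons.
    rewrite /= iter_rot; elim: k => [|k IH] /=; first by rewrite cats0.
    by rewrite -catA IH.
  have z_gt0 : (0 < size z)%N by move: n_gt0; rewrite nE muln_gt0 => /andP[].
  by rewrite wn => /(dvdn_leq z_gt0); rewrite leqNgt nE ltn_Pmull.
apply: contrapT => en; apply: w_prim.
have e_gt0 : (0 < order rotT w)%N := order_gt0 _ _.
set e := order rotT w in en e_gt0 *.
have [k nE] := dvdnP (order_dvdn w); rewrite -/e in nE.
have k1 : (1 < k)%N by case: k nE => [|[|//]]; lia.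
have /(congr1 val) : iter e rotT w = w by apply: iter_order rotT_inj _.
rewrite /= val_iter_rotT.
have iter_rot i : (i <= n)%N -> iter i (rot 1) w = rot i w.
  elim: i => [|i IH] ilt; first by rewrite rot0.
  by rewrite iterS IH ?(ltnW ilt) // -rotS ?size_tuple.
have e_n : (e <= n)%N by rewrite nE leq_pmull //; lia.
rewrite iter_rot // => wE.
exists (take e w), k; split=> //.
rewrite -{1}(cat_take_drop e w); case: k k1 nE => // k k1 nE /=; congr (_ ++ _).
have sz : size (take e w) = e by rewrite size_takel ?size_tuple.
apply: rot_commute_flatten; last by rewrite sz size_drop size_tuple nE mulSn addKn.
by rewrite cat_take_drop; apply: esym.
Qed.

(** If rotation by i dualizes w, then 2i is a multiple of n, so i = kh. As no nonempty word is its
    own dual, k is odd, and i is h modulo n. *)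
Lemma self_dual_wordE (h : nat) w : n = h.*2 -> (0 < n)%N -> order rotT w = n ->
  self_dual_word w <-> iter h rotT w = starT w.
Proof.
move=> nE n_gt0 wn; split=> [[i wi]|wh]; last first.
  by exists h; rewrite -val_iter_rotT wh.
have {}wi : starT w = iter i rotT w by apply/val_inj; rewrite /= val_iter_rotT.
have /eqP : iter (i + i) rotT w = w by rewrite iterD -wi -starT_iter -wi starTK.
rewrite (iter_id_order rotT_inj) wn {1}nE addnn -!muln2 dvdn_pmul2r // => /dvdnP[k iE].
have kodd : odd k.
  apply: contraT => k_even; have := starT_neq w n_gt0.
  rewrite wi (iter_id_order rotT_inj) wn iE nE.
  have -> : (k * h = k./2 * h.*2)%N.
    by rewrite -{1}(odd_double_half k) (negPf k_even) add0n -doubleMl doubleMr.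
  by rewrite dvdn_mull.
rewrite wi iE -(odd_double_half k) kodd mulnDl mul1n iterD.
have -> : (k./2.*2 * h = k./2 * n)%N by rewrite nE; lia.
suff -> : iter (k./2 * n) rotT w = w by [].
by apply/eqP; rewrite (iter_id_order rotT_inj) wn dvdn_mull.
Qed.

Lemma card_primitive : (0 < n)%N ->
  #|[set w | order rotT w == n]|%:Z =
  \sum_(d <- divisors n) mobius d * 2 ^+ (n %/ d).
Proof.
move=> n_gt0.
have -> : [set w | order rotT w == n] = [set w in [set: n.-tuple bool] | order rotT w == n].
  by apply/setP => w; rewrite !inE.
rewrite (sum_mobius_period rotT_inj n_gt0) => [|w _]; last exact: iter_rotT_n.
rewrite !big_seq; apply: eq_bigr => d; rewrite -dvdn_divisors // => dn; congr (_ * _).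
have d_gt0 := dvdn_gt0 n_gt0 dn.
rewrite -[RHS]natrX -[in RHS](@card_antiperiodic n (n %/ d) d false) ?divnK //;
  last by rewrite divn_gt0 // dvdn_leq.
rewrite natz; congr (Posz #|pred_of_set _|); apply/setP => w; rewrite !inE.
rewrite -[_ == w]/(val _ == val w) /= val_iter_rotT.
by rewrite map_id.
Qed.

(* If the half-period h negates w, then n / d is a period of w only for odd d,
   and then h / d already negates w. *)
Lemma card_primitive_self_dual (h : nat) : n = h.*2 -> (0 < n)%N ->
  #|[set w | (order rotT w == n) && (iter h rotT w == starT w)]|%:Z =
  \sum_(d <- divisors n | odd d) mobius d * 2 ^+ (n %/ (2 * d)).
Proof.
move=> nE n_gt0.
have -> : [set w | (order rotT w == n) && (iter h rotT w == starT w)] =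
          [set w in [set w | iter h rotT w == starT w] | order rotT w == n].
  by apply/setP => w; rewrite !inE andbC.
rewrite (sum_mobius_period rotT_inj n_gt0) => [|w _]; last exact: iter_rotT_n.
have starT_iterM i w : iter i rotT w = starT w ->
    forall k, iter (k * i) rotT w = if odd k then starT w else w.
  move=> wi; elim=> //= k IH; rewrite mulSn iterD IH.
  by case: (odd k); rewrite /= -?starT_iter wi // starTK.
rewrite [RHS]big_mkcond !big_seq; apply: eq_bigr => d.
rewrite -dvdn_divisors // => dn; have d_gt0 := dvdn_gt0 n_gt0 dn.
case: ifP => d_odd; last first.
  suff -> : [set w in [set w | iter h rotT w == starT w] | iter (n %/ d) rotT w == w] = set0.
    by rewrite cards0 mulr0.
  apply/setP => w; rewrite !inE; apply/negP => /andP[/eqP wh].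
  rewrite (iter_id_order rotT_inj) => wd.
  (* For even d, h is a multiple of n / d, so it would be a period. *)
  suff : iter h rotT w == w by rewrite wh; apply/negP/starT_neq.
  rewrite (iter_id_order rotT_inj) (dvdn_trans wd) //.
  have -> : h = (n %/ d * d./2)%N.
    apply: double_inj; rewrite -nE -muln2 -mulnA muln2 -[d./2.*2]/(false + d./2.*2)%N.
    by rewrite -d_odd odd_double_half divnK.
  by rewrite dvdn_mulr.
have dh : (d %| h)%N.
  have : (d %| 2 * h)%N by rewrite mul2n -nE.
  by rewrite Gauss_dvdr // coprimen2.
have n2d : (n %/ (2 * d) = h %/ d)%N by rewrite nE -mul2n divnMl.
have nd : (n %/ d = h %/ d + h %/ d)%N by rewrite nE -addnn divnDl.
have h_gt0 : (0 < h)%N by rewrite -double_gt0 -nE.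
congr (_ * _).
rewrite n2d -[RHS]natrX.
(* The word consists of 2d blocks of length h / d, an even number as alternating negation
   requires. *)
rewrite -[in RHS](@card_antiperiodic n (h %/ d) d.*2 true) ?odd_double ?double_gt0 //;
  first last.
- by rewrite divn_gt0 // dvdn_leq.
- by rewrite -doubleMr divnK.
rewrite natz; congr (Posz #|pred_of_set _|); apply/setP => w; rewrite !inE.
rewrite -val_iter_rotT -[X in _ = (_ == X)]/(val (starT w)) [RHS]val_eqE.
apply/andP/eqP => [[/eqP wh /eqP wd]|wd].
  (* As d is odd, h is h / d plus a multiple of the period n / d. *)
  have -> : starT w = iter (h %/ d + d./2 * (n %/ d)) rotT w.
    rewrite -wh -{1}(divnK dh) nd; congr iter.
    by rewrite -{2}(odd_double_half d) d_odd mulnDr muln1 addnn -muln2; lia.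
  rewrite iterD; congr iter; apply/esym/eqP.
  by rewrite (iter_id_order rotT_inj) dvdn_mull // -(iter_id_order rotT_inj) wd.
have wk := starT_iterM _ _ wd.
split; apply/eqP; first by rewrite -{1}(divnK dh) mulnC wk d_odd.
by rewrite nd addnn -mul2n wk.
Qed.

End Words.

(** In the applications f sends a word to its isomorphism class and e describes isomorphism
    combinatorially. One representative per block of e enumerates the classes. *)
Lemma has_card_quotient (T : finType) (X : Type) (A : {set T}) (f : T -> X)
    (e : rel T) (c : nat) :
  (0 < c)%N ->
  {in A &, forall x y, f x = f y <-> e x y} ->
  {in A, forall x, #|[set y in A | e x y]| = c} ->
  exists N : nat, has_card (fun C => exists2 x, x \in A & C = f x) N /\
                  (N * c = #|A|)%N.
Proof.
move=> c_gt0 fe e_card.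
have eP : {in A & &, equivalence_rel e}.
  move=> x y z xA yA zA; split; first exact/fe.
  by move=> /fe-/(_ xA yA) xy; apply/idP/idP => /fe h; apply/fe => //;
    rewrite -?xy ?h // xy h.
have partP := equivalence_partitionP eP.
set P := equivalence_partition e A in partP.
have [r rP] : {r : 'I_#|P| -> T & forall i, r i \in A /\ enum_val i = [set y in A | e (r i) y]}.
  apply: (@choice _ _ (fun i x => x \in A /\ enum_val i = [set y in A | e x y])) => i.
  by have /imsetP[x xA ->] := enum_valP i; exists x.
exists #|P|; split; last first.
  by rewrite (@card_uniform_partition _ c _ _ _ partP) // => B /imsetP[x xA ->]; exact: e_card.
exists (f \o r); split=> [i j /= fij|C].
  have [[iA iE] [jA jE]] := (rP i, rP j).
  apply: enum_val_inj; rewrite iE jE; apply/setP => y; rewrite !inE.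
  have [yA|//] := boolP (y \in A).
  by apply/idP/idP => /fe h; apply/fe => //=; rewrite ?fij ?h // -fij h.
split=> [[x xA ->]|[i <-]]; last by exists (r i) => //; case: (rP i).
have xP : [set y in A | e x y] \in P by apply: imset_f.
exists (enum_rank_in xP [set y in A | e x y]) => /=.
have [rA] := rP (enum_rank_in xP [set y in A | e x y]).
rewrite enum_rankK_in // => /setP /(_ x); rewrite !inE xA /=.
have -> : e x x by apply/fe.
by move=> /esym /fe ->.
Qed.

(** * Isomorphisms of unitary modules *)

Section Isomorphisms.
Variables (k : fieldType) (p : nat).
Implicit Types M N L : unitaryBT1 k p.

Definition bt_part M (i : bool) : {vspace M} := if i then bt_M1 M else bt_M0 M.

(* For [c = true] the isomorphism exchanges the two Lagrangian parts. *)
Definition bt_iso (c : bool) M N : Prop :=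
  exists g : {linear M -> N},
    [/\ bijective g,
        forall x, g (bt_F x) = bt_F (g x),
        forall x, g (bt_V x) = bt_V (g x),
        forall x y, bt_form N (g x) (g y) = bt_form M x y
      & forall i x, (g x \in bt_part N (c (+) i)) = (x \in bt_part M i)].

Lemma bt_iso_false M N : bt_iso false M N <-> bt_isomorphic M N.
Proof.
split=> [[g [g_bij gF gV g_form g_part]]|[g [g_bij [gF gV] g_form g0 g1]]].
  by exists g; split=> // x; [exact: (g_part false) | exact: (g_part true)].
by exists g; split=> // -[] x /=.
Qed.

Lemma bt_iso_refl M : bt_iso false M M.
Proof. by exists idfun; split=> //; exists id. Qed.

Lemma bt_iso_sym c M N : bt_iso c M N -> bt_iso c N M.
Proof.
move=> [g [g_bij gF gV g_form g_part]].
(* Inverting g as a [linfun] yields an inverse with a linear structure. *)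
have gE x : linfun g x = g x by rewrite lfunE.
have g_ker : lker (linfun g) == 0%VS.
  by apply/lker0P => x y; rewrite !gE; apply: bij_inj.
have gK x : (linfun g)^-1%VF (g x) = x by rewrite -gE lker0_lfunK.
have gKV x : g ((linfun g)^-1%VF x) = x.
  by have [g' _ g'K] := g_bij; rewrite -(g'K x) gK.
exists (linfun g)^-1%VF; split.
- by exists g.
- by move=> x; apply: (bij_inj g_bij); rewrite gF !gKV.
- by move=> x; apply: (bij_inj g_bij); rewrite gV !gKV.
- by move=> x y; rewrite -g_form !gKV.
- by move=> i x; rewrite -g_part addbA addbb gKV.
Qed.

Lemma bt_iso_trans c d M N L : bt_iso c M N -> bt_iso d N L -> bt_iso (d (+) c) M L.
Proof.
move=> [g [g_bij gF gV g_form g_part]] [h [h_bij hF hV h_form h_part]].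
exists (h \o g); split=> [||||i] //=.
- exact: bij_comp.
- by move=> x; rewrite gF hF.
- by move=> x; rewrite gV hV.
- by move=> x y; rewrite h_form g_form.
- by move=> x; rewrite -addbA h_part g_part.
Qed.

Lemma eq_iso_class M N : iso_class M = iso_class N <-> bt_iso false M N.
Proof.
split=> [MN|MN].
  have : iso_class M N by rewrite MN; apply/bt_iso_false/bt_iso_refl.
  by move/bt_iso_false.
apply/funext => L; apply/propext; split=> /bt_iso_false ML; apply/bt_iso_false.
  exact: (bt_iso_trans (bt_iso_sym MN) ML).
exact: (bt_iso_trans MN ML).
Qed.

Lemma ker_dim_inj M (U : {vspace M}) m n : ker_dim U m -> ker_dim U n -> m = n.
Proof.
move=> [K [KP <-]] [K' [KP' <-]]; congr (\dim _); apply/vspaceP => x.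
by apply/idP/idP => [/KP/KP'|/KP'/KP].
Qed.

Lemma ker_dim_iso c M N i n :
  bt_iso c M N -> ker_dim (bt_part M i) n -> ker_dim (bt_part N (c (+) i)) n.
Proof.
move=> [g [g_bij gF gV g_form g_part]] [K [KP <-]].
have gE x : linfun g x = g x by rewrite lfunE.
have g_ker : lker (linfun g) == 0%VS.
  by apply/lker0P => x y; rewrite !gE; apply: bij_inj.
have [g' gK g'K] := g_bij.
exists (linfun g @: K)%VS; split; last first.
  by apply: limg_dim_eq; rewrite (eqP g_ker) capv0.
move=> x; split=> [/memv_imgP[y /KP[yM Fy] ->]|[xN Fx]].
  by rewrite gE g_part -gF Fy linear0.
apply/memv_imgP; exists (g' x); rewrite ?gE ?g'K //; apply/KP; split.
  by rewrite -g_part g'K.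
by apply: (bij_inj g_bij); rewrite gF g'K Fx linear0.
Qed.

Lemma has_signature_iso M N s : bt_iso false M N -> has_signature M s -> has_signature N s.
Proof.
move=> MN [s1 s2]; split; first exact: (@ker_dim_iso false M N true).
exact: (@ker_dim_iso false M N false).
Qed.

(** The head of s is the letter u_0, followed first. For v the step goes to any z with [x = V z];
    since V need not be injective, this is a relation and not a function. *)
Fixpoint chain (T : Type) (F V : T -> T) (s : word) (x y : T) : Prop :=
  if s is u :: s' then
    exists z, (if u then z = F x else x = V z) /\ chain F V s' z y
  else x = y.

(* [stem M s] holds exactly when s can be read off, cyclically, from one of the
   words of M, see [stem_tildeM] and [stem_factor]. *)
Definition stem M (s : word) : Prop :=
  exists x : M, (exists y, chain (@bt_F k p M) (@bt_V k p M) s x y) /\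
                ~ chain (@bt_F k p M) (@bt_V k p M) s x 0.

(** Stems involve only F and V, so they also survive isomorphisms that exchange the Lagrangian
    parts. *)
Lemma stem_iso c M N s : bt_iso c M N -> stem M s -> stem N s.
Proof.
move=> [g [g_bij gF gV _ _]] [x [[y xy] x0]].
have [g' gK g'K] := g_bij.
exists (g x); split.
  exists (g y); elim: s x xy {x0} => [|u s IH] x /=; first by move->.
  move=> [z [xz /IH zy]]; exists (g z); split=> //.
  by case: u xz => ->; rewrite ?gF ?gV.
move=> gx0; apply: x0.
have {gx0} : chain (@bt_F k p N) (@bt_V k p N) s (g x) (g 0) by rewrite linear0.
elim: s x {y xy} => [|u s IH] x /=; first exact: (bij_inj g_bij).
move=> [z [xz]]; rewrite -(g'K z) => /IH zy; exists (g' z); split=> //.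
case: u xz => [->|xz]; first by rewrite -gF gK.
by apply: (bij_inj g_bij); rewrite gV g'K.
Qed.

End Isomorphisms.

(** * Isomorphisms between standard modules *)

Section Standard.
Variables (k : closedFieldType) (p : nat).
Hypothesis (pchark : p \in [pchar k]).

Let p_gt0 : (0 < p)%N.
Proof. by apply: prime_gt0; case/andP: pchark. Qed.

Let exp0p : (0 : k) ^+ p = 0.
Proof. by rewrite expr0n eqn0Ngt p_gt0. Qed.

Let expNp (a : k) : (- a) ^+ p = - a ^+ p.
Proof. by rewrite -(add0r (- a)) (pfrobB pchark) exp0p add0r. Qed.

Let prootN (a : k) : proot p (- a) = - proot p a.
Proof. by apply: (pfrob_inj pchark); rewrite /= expNp !(prootK pchark). Qed.

Section Pull.
Variables (l l' : nat) (e : 'I_l' -> 'I_l) (c : bool).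

(* For [c = true] the two summands are exchanged, with the sign that makes the
   exchange symplectic. *)
Definition pull (x : 'rV[k]_l * 'rV[k]_l) : 'rV[k]_l' * 'rV[k]_l' :=
  if c then (\row_i x.2 ord0 (e i), \row_i - x.1 ord0 (e i))
  else (\row_i x.1 ord0 (e i), \row_i x.2 ord0 (e i)).

Lemma pull_linear : linear pull.
Proof.
move=> a x y; rewrite /pull; case: c; congr pair; apply/rowP => i; rewrite !mxE //.
by rewrite mulrN opprD.
Qed.

HB.instance Definition _ :=
  GRing.isLinear.Build k ('rV[k]_l * 'rV[k]_l)%type ('rV[k]_l' * 'rV[k]_l')%type *:%R
    pull pull_linear.

Lemma pull_bij : bijective e -> bijective pull.
Proof.
move=> [e' eK e'K].
exists (fun x : 'rV[k]_l' * 'rV[k]_l' =>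
  if c then (\row_i - x.2 ord0 (e' i), \row_i x.1 ord0 (e' i))
  else (\row_i x.1 ord0 (e' i), \row_i x.2 ord0 (e' i)));
  by move=> [x y]; rewrite /pull; case: c; congr pair;
     apply/rowP => i; rewrite !mxE ?opprK ?eK ?e'K.
Qed.

End Pull.

(** Dualizing the letters (c) and reversing the parity of the indices (d) each exchange the
    Lagrangian parts, whence [c (+) d]. *)
Lemma tildeM_iso (w w' : word) (w_even : ~~ odd (size w)) (w'_even : ~~ odd (size w'))
    (e : 'I_(size w') -> 'I_(size w)) (c d : bool) :
  bijective e -> (forall i, e (ordS i) = ordS (e i)) ->
  (forall i : 'I_(size w'), nth false w' i = c (+) nth false w (e i)) ->
  (forall i, odd (e i) = d (+) odd i) ->
  bt_iso (c (+) d) (tildeM pchark w_even) (tildeM pchark w'_even).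
Proof.
move=> e_bij eS e_w e_odd.
have eP i : e (ord_pred i) = ord_pred (e i).
  by apply: (@ordS_inj (size w)); rewrite -eS !ord_predK.
exists (pull e c); split.
- exact: pull_bij.
- move=> x; rewrite /pull /= /tildeF.
  case: c e_w => e_w; congr pair; apply/rowP => i;
    rewrite !mxE ?nth_word_star e_w -?eP /=; case: (nth _ w _); rewrite /= ?mxE //;
    by rewrite ?expNp ?oppr0.
- move=> x; rewrite /pull /= /tildeV.
  case: c e_w => e_w; congr pair; apply/rowP => i;
    rewrite !mxE ?nth_word_star e_w -?eS /=; case: (nth _ w _); rewrite /= ?mxE //;
    by rewrite ?prootN ?oppr0.
- move=> x y; rewrite /pull /= /stdform [RHS](reindex e) /=; last exact: onW_bij.
  by case: c {e_w}; apply: eq_bigr => i _; rewrite /= !mxE; ring.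
have partE (u : word) (u_even : ~~ odd (size u)) i :
    bt_part (tildeM pchark u_even) i = std_part k (size u) i by case: i.
have [e' eK e'K] := e_bij.
move=> i x; rewrite !partE; apply/idP/idP => /mem_std_part xP; apply/mem_std_part => j.
  have := xP (e' j); rewrite /pull.
  have -> : odd (e' j) = d (+) odd j by rewrite -{2}(e'K j) e_odd addbA addbb.
  case: c {e_w xP}; case: d {e_odd}; case: i; case: (odd j); rewrite /= !mxE e'K //;
    by move/eqP; rewrite oppr_eq0 => /eqP.
have := xP (e j); rewrite /pull e_odd.
by case: c {e_w xP}; case: d {e_odd}; case: i; case: (odd j); rewrite /= !mxE // => ->;
  rewrite oppr0.
Qed.

Lemma tildeM_rot1 (w : word) (w_even : ~~ odd (size w)) (w'_even : ~~ odd (size (rot 1 w))) :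
  bt_iso true (tildeM pchark w_even) (tildeM pchark w'_even).
Proof.
pose e i := ordS (cast_ord (size_rot 1 w) i).
have e_odd i : odd (e i) = true (+) odd i by rewrite odd_ordS.
apply: (@tildeM_iso _ _ _ _ e false true) => //.
- apply: (@Bijective _ _ _ (fun i => cast_ord (esym (size_rot 1 w)) (ord_pred i))) => i.
    by rewrite /e ordSK cast_ordK.
  by rewrite /e cast_ordKV ord_predK.
- by move=> i; apply: val_inj => /=; congr (_.+1 %% _)%N; congr (_ %% _)%N; exact: size_rot.
- move=> i; have i_lt : (i < size w)%N by apply: leq_trans (ltn_ord i) _; rewrite size_rot.
  by rewrite -[rot 1 w]/(iter 1 (rot 1) w) nth_iter_rot //= addn1.
Qed.

Lemma tildeM_star (w : word) (w_even : ~~ odd (size w))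
    (w'_even : ~~ odd (size (word_star w))) :
  bt_iso true (tildeM pchark w_even) (tildeM pchark w'_even).
Proof.
pose e i := cast_ord (size_map negb w) i.
apply: (@tildeM_iso _ _ _ _ e true false) => //.
- by apply: (@Bijective _ _ _ (cast_ord (esym (size_map negb w)))) => i;
    rewrite /e ?cast_ordK ?cast_ordKV.
- by move=> i; apply: val_inj => /=; congr (_ %% _)%N; exact: size_map.
- move=> i; rewrite (nth_map false) //.
  by apply: leq_trans (ltn_ord i) _; rewrite size_map.
Qed.

(** * Chains in coordinates *)

Section Coordinates.
Variables (w : word) (l : nat).
Local Notation F := (@stdF k p w l).
Local Notation V := (@stdV k p w l).
Implicit Types (s : word) (i j : 'I_l) (K : pred 'I_l) (x y : 'rV[k]_l).

Definition mask K x : 'rV[k]_l := \row_i if K i then x ord0 i else 0.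
(** K is the set of coordinates still alive; a letter u moves it one index forward and drops the
    indices whose letter in w is not u. *)
Definition advance (u : bool) K : pred 'I_l :=
  fun i => K (ord_pred i) && (u == nth false w (ord_pred i)).
Definition advances s K : pred 'I_l := foldl (fun K u => advance u K) K s.

(* Coordinates travel independently along a chain, and one that meets a letter
   different from its own can be set to 0 from there on. *)
Lemma chain_mask s K x y : chain F V s x y -> chain F V s (mask K x) (mask (advances s K) y).
Proof.
elim: s K x => [|u s IH] K x /=; first by move->.
move=> [z [xz /IH zy]]; exists (mask (advance u K) z); split=> //.
case: u {zy} xz => ->; apply/rowP => i; rewrite !mxE /advance ?ordSK.
  by case: (K _) => /=; case: (nth _ _ _) => //=; rewrite exp0p.
by case: (K _) => /=; case: (nth _ _ _); rewrite //= (proot0 pchark).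
Qed.

Lemma iter_ordS i t : iter t (@ordS l) i = ((i + t) %% l)%N :> nat.
Proof.
elim: t => [|t IH]; first by rewrite addn0 modn_small.
by rewrite iterS /= IH -addn1 modnDml addn1 addnS.
Qed.

Definition reads s i :=
  forall t, (t < size s)%N -> nth false s t = nth false w (iter t (@ordS l) i).

Lemma reads_cons u s i : reads (u :: s) i <-> u = nth false w i /\ reads s (ordS i).
Proof.
split=> [usi|[ui si] [|t] //= st]; last by rewrite si // -iterSr.
by split=> [|t st]; [exact: (usi 0%N) | rewrite -iterSr; apply: (usi t.+1)].
Qed.

Lemma advances_reads s K i : advances s K i -> exists2 j, K j & reads s j.
Proof.
elim: s K => [|u s IH] K /=; first by exists i.
move=> /IH[j /andP[Kj /eqP uj] sj]; exists (ord_pred j) => //.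
by apply/reads_cons; rewrite ord_predK.
Qed.

Lemma reads_rot s j : size w = l -> size s = l -> reads s j -> s = iter j (rot 1) w.
Proof.
move=> wl sl sj; apply: (@eq_from_nth _ false); first by rewrite size_iter_rot wl.
move=> t ts; rewrite sj // iter_ordS nth_iter_rot wl; first by rewrite addnC.
by rewrite -sl.
Qed.

Lemma chain0 s : chain F V s 0 0.
Proof.
elim: s => //= u s IH; exists 0; split=> //.
by case: u; apply/rowP => i; rewrite !mxE ?exp0p ?(proot0 pchark); case: ifP.
Qed.

Lemma chain_reads s i : reads s i ->
  chain F V s (delta_mx ord0 i) (delta_mx ord0 (iter (size s) (@ordS l) i)).
Proof.
elim: s i => //= u s IH i /reads_cons[ui /IH si].
exists (delta_mx ord0 (ordS i)); split; last by rewrite -iterS iterSr.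
by case: u ui => ui; rewrite ?(stdF_delta pchark) ?(stdV_delta pchark) -ui.
Qed.

(** Along matching letters a coordinate only undergoes p-th powers and p-th roots, which keep it
    nonzero. *)
Lemma chain_reads_neq0 s i x y : reads s i -> chain F V s x y ->
  x ord0 i != 0 -> y ord0 (iter (size s) (@ordS l) i) != 0.
Proof.
elim: s i x => [|u s IH] i x /=; first by move=> _ ->.
move=> /reads_cons[ui si] [z [xz /(IH _ _ si) zy]] xi; rewrite -iterS iterSr; apply: zy.
case: u ui xz => ui xz; first by rewrite xz mxE ordSK -ui expf_neq0.
by move: xi; rewrite xz mxE -ui; apply: contraNneq => ->; rewrite (proot0 pchark).
Qed.

(** Every coordinate meets a wrong letter on the way, so masking turns the end of the chain into 0
    without changing x. *)
Lemma chain_not_reads s x y : (forall j, ~ reads s j) -> chain F V s x y -> chain F V s x 0.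
Proof.
move=> sN /(@chain_mask _ predT).
have -> : mask predT x = x by apply/rowP => i; rewrite mxE.
suff -> : mask (advances s predT) y = 0 by [].
by apply/rowP => i; rewrite !mxE; case: ifP => // /advances_reads[j _ /sN].
Qed.

End Coordinates.

Lemma chain_tildeM (w : word) (w_even : ~~ odd (size w)) s
    (x y : tildeM pchark w_even) :
  chain (@bt_F _ _ (tildeM pchark w_even)) (@bt_V _ _ (tildeM pchark w_even)) s x y <->
  chain (@stdF k p w (size w)) (@stdV k p w (size w)) s x.1 y.1 /\
  chain (@stdF k p (word_star w) (size w)) (@stdV k p (word_star w) (size w)) s x.2 y.2.
Proof.
elim: s x => [|u s IH] x /=.
  by split=> [->|[]] //; case: x => ? ?; case: y => ? ? /= -> ->.
split=> [[z [xz /IH[zy1 zy2]]]|[[z1 [xz1 zy1]] [z2 [xz2 zy2]]]].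
  by split; [exists z.1 | exists z.2]; split=> //; case: u xz => ->.
exists (z1, z2); split; last exact/IH.
by case: u xz1 xz2 => [-> ->|] //; case: x {IH} => x1 x2 /= -> ->.
Qed.

End Standard.

(** * Stems and signatures of standard modules *)

Section StemsAndSignatures.
Variables (k : closedFieldType) (p : nat).
Hypothesis (pchark : p \in [pchar k]).

Lemma stem_tildeM (w : word) (w_even : ~~ odd (size w)) :
  w != [::] -> stem (tildeM pchark w_even) w.
Proof.
rewrite -size_eq0 -lt0n => w_gt0; pose i0 := Ordinal w_gt0.
have w0 : reads w w i0 by move=> t tw; rewrite iter_ordS add0n modn_small.
(* From a_0 the word is read along basis vectors, and the nonzero coordinate keeps 0 out of
   reach. *)
exists (delta_mx ord0 i0, 0); split.
  exists (delta_mx ord0 (iter (size w) (@ordS _) i0), 0).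
  by apply/chain_tildeM; split; [exact: chain_reads | exact: chain0].
move=> /chain_tildeM[/= /(chain_reads_neq0 pchark w0)]; rewrite !mxE !eqxx oner_eq0.
by move/(_ isT).
Qed.

(** If s were read in neither word, both components of x could be led to 0. *)
Lemma stem_factor (w : word) (w_even : ~~ odd (size w)) (s : word) :
  size s = size w -> stem (tildeM pchark w_even) s ->
  exists j : nat, s = iter j (rot 1) w \/ s = iter j (rot 1) (word_star w).
Proof.
move=> sw [x [[y /chain_tildeM[xy1 xy2]] x0]].
have [[j]|N1] := pselect (exists j : 'I_(size w), reads w s j).
  by move/(reads_rot erefl sw); exists j; left.
have [[j]|N2] := pselect (exists j : 'I_(size w), reads (word_star w) s j).
  by move/(reads_rot (size_map negb w) sw); exists j; right.
case: x0; apply/chain_tildeM; split.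
  by apply: (chain_not_reads pchark _ xy1) => j js; apply: N1; exists j.
by apply: (chain_not_reads pchark _ xy2) => j js; apply: N2; exists j.
Qed.

(** For each j, part c contains a_j if j has parity c, and b_j otherwise. F kills a_j when letter j
    is v and b_j when it is f; in both cases the letter equals [c (+) odd j]. *)
Lemma ker_dim_tildeM (w : word) (w_even : ~~ odd (size w)) (c : bool) :
  ker_dim (bt_part (tildeM pchark w_even) c)
    #|[pred j : 'I_(size w) | nth false w j == c (+) odd j]|.
Proof.
set l := size w; set A := [pred j | _].
(* [e j] is the one of a_j and b_j that lies in part c, and [m j] is its coordinate. *)
pose e (j : 'I_l) : 'rV[k]_l * 'rV[k]_l := if odd j == c then std_a k j else std_b k j.
pose m (j : 'I_l) (x : 'rV[k]_l * 'rV[k]_l) := if odd j == c then x.1 ord0 j else x.2 ord0 j.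
have m_sum (I : finType) (P : pred I) f j : m j (\sum_(i | P i) f i) = \sum_(i | P i) m j (f i).
  rewrite /m; case: ifP => _; last by rewrite (raddf_sum snd) summxE.
  by rewrite (raddf_sum fst) summxE.
have m_e i j a : m i (a *: e j) = a * (i == j)%:R.
  rewrite /m /e; case: ifP => ic; case: ifP => jc; rewrite !mxE //.
    by have [ij|_] := eqVneq i j; rewrite ?mulr0 //; rewrite ij jc in ic.
  by have [ij|_] := eqVneq i j; rewrite ?mulr0 //; rewrite ij jc in ic.
have partE : bt_part (tildeM pchark w_even) c = std_part k l c by case: (c).
have part_e j : e j \in std_part k l c.
  apply/mem_std_part => i; rewrite /e; case: ifP => ic; case: ifP => jc; rewrite !mxE //=.
    by have [ij|_] := eqVneq i j; rewrite //= -ij ic in jc.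
  by have [ij|_] := eqVneq i j; rewrite //= -ij ic in jc.
have part_sum x : x \in std_part k l c -> x = \sum_j m j x *: e j.
  move=> /mem_std_part xP.
  have m_x j : m j (\sum_i m i x *: e i) = m j x.
    rewrite m_sum (bigD1 j) //= big1 ?addr0 => [|i ij]; rewrite m_e ?eqxx ?mulr1 //.
    by rewrite eq_sym (negPf ij) mulr0.
  have /mem_std_part sP : \sum_i m i x *: e i \in std_part k l c.
    by apply: memv_suml => i _; apply: memvZ.
  apply/eqP; rewrite -[_ == _]/((_ == _) && (_ == _)).
  apply/andP; split; apply/eqP/rowP => j; have := m_x j; have := sP j; have := xP j;
    rewrite /m; by case: ifP => // _ -> ->.
exists (\sum_(j | A j) <[e j]>)%VS; split; last first.
  have /directvP/= -> : directv (\sum_(j | A j) <[e j]>)%VS.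
    apply/directv_sum_independent => u uP u0 i Ai.
    have uE j : A j -> exists a, u j = a *: e j by move=> /uP/vlineP.
    have [a ua] := uE i Ai.
    have : m i (\sum_(j | A j) u j) = 0 by rewrite u0 /m; case: ifP; rewrite mxE.
    rewrite m_sum (bigD1 i) //= big1 => [|j /andP[/uE[b ->] ij]]; last first.
      by rewrite m_e eq_sym (negPf ij) mulr0.
    by rewrite addr0 ua m_e eqxx mulr1 => ->; rewrite scale0r.
  rewrite -sum1_card; apply: eq_bigr => j _; rewrite dim_vline.
  suff -> : e j != 0 by [].
  by apply/eqP => ej; have := m_e j j 1; rewrite eqxx scale1r mulr1 ej /m;
    case: ifP => _; rewrite mxE => /eqP; rewrite eq_sym oner_eq0.
have F0 v : stdF p v (0 : 'rV[k]_l) = 0.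
  apply/rowP => i; rewrite !mxE expr0n eqn0Ngt prime_gt0 ?if_same //.
  by case/andP: pchark.
rewrite partE => x; split=> [|[xP /= Fx]].
  move=> /memv_sumP[u uP ->]; split; first by apply: memv_suml => j /uP/vlineP[a ->]; apply: memvZ.
  rewrite /=; elim/big_ind: _ => [|y z y0 z0|j Aj].
  - by rewrite /tildeF !F0.
  - by rewrite (tildeFD pchark) y0 z0 addr0.
  have /vlineP[a ->] := uP j Aj; rewrite tildeFZ.
  suff -> : @tildeF k p w (e j) = 0 by rewrite scaler0.
  move: Aj; rewrite /A /= /e /tildeF => /eqP wj.
  case: ifP => jc; rewrite /= F0 (stdF_delta pchark) ?nth_word_star wj.
    by rewrite -(eqP jc) addbb.
  by move: jc; case: (odd j); case: (c).
rewrite (part_sum x xP); apply: memv_suml => j _.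
have [Aj|NAj] := boolP (A j).
  by apply: memvZ; apply: subvP (memv_line _); rewrite (sumv_sup j).
suff -> : m j x = 0 by rewrite scale0r mem0v.
move: NAj; rewrite /A /= /m => wj.
(* Coordinate j of x, unless its letter kills it, reappears as a p-th power in coordinate j + 1 of F
   x. *)
move: Fx => [/rowP/(_ (ordS j)) F1 /rowP/(_ (ordS j)) F2].
move: F1 F2; rewrite !mxE !ordSK nth_word_star.
case: ifP => jc; move: jc wj; case: (nth _ w j); case: (odd j); case: (c) => //= _ _;
  do ?[by move=> /(pfrob_eq0 pchark) | by move=> _ /(pfrob_eq0 pchark)].
Qed.

(** The index sets counting the two kernels are complementary, so the entries of the signature add
    up to the length of w. *)
Lemma tildeM_size_signature (w : word) (w_even : ~~ odd (size w)) (h : nat) :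
  has_signature (tildeM pchark w_even) (h, h) -> size w = h.*2.
Proof.
move=> [/= h1 h0].
have := ker_dim_inj h1 (ker_dim_tildeM w_even true).
have := ker_dim_inj h0 (ker_dim_tildeM w_even false) => /= e0 e1.
rewrite -addnn {1}e0 e1 -[LHS]card_ord.
rewrite -(cardC [pred j : 'I_(size w) | nth false w j == odd j]); congr (_ + _)%N.
by apply: eq_card => j; rewrite !inE; case: (nth _ _ _); case: (odd j).
Qed.

(** An automorphism exchanging the parts equates the two kernel dimensions, whose sum is the
    length. *)
Lemma tildeM_signature (w : word) (w_even : ~~ odd (size w)) (h : nat) :
  bt_iso true (tildeM pchark w_even) (tildeM pchark w_even) ->
  size w = h.*2 -> has_signature (tildeM pchark w_even) (h, h).
Proof.
move=> ww wh.
have h1 := ker_dim_tildeM w_even true; have h0 := ker_dim_tildeM w_even false.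
have e01 := ker_dim_inj (ker_dim_iso ww h0) h1.
suff eh : #|[pred j : 'I_(size w) | nth false w j == true (+) odd j]| = h.
  by split; rewrite /= -eh // -e01.
apply: double_inj; rewrite -wh -addnn -{1}e01 -[RHS]card_ord.
rewrite -(cardC [pred j : 'I_(size w) | nth false w j == odd j]); congr (_ + _)%N.
by apply: eq_card => j; rewrite !inE; case: (nth _ _ _); case: (odd j).
Qed.

Lemma tildeM_iter_rot (w : word) (i : nat) (w_even : ~~ odd (size w))
    (w'_even : ~~ odd (size (iter i (rot 1) w))) :
  bt_iso (odd i) (tildeM pchark w_even) (tildeM pchark w'_even).
Proof.
elim: i w'_even => [|i IH] w'_even.
  by rewrite /= (bool_irrelevance w'_even w_even); apply: bt_iso_refl.
have wi_even : ~~ odd (size (iter i (rot 1) w)) by rewrite size_iter_rot.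
rewrite -[odd _]/(true (+) odd i).
exact: bt_iso_trans (IH wi_even) (tildeM_rot1 _ _ _).
Qed.

Lemma tildeM_iso_factor (w w' : word) (w_even : ~~ odd (size w))
    (w'_even : ~~ odd (size w')) :
  w != [::] -> size w = size w' ->
  bt_iso false (tildeM pchark w_even) (tildeM pchark w'_even) ->
  exists j : nat, w = iter j (rot 1) w' \/ w = iter j (rot 1) (word_star w').
Proof.
move=> w_neq0 ww' /stem_iso/(_ (stem_tildeM w_even w_neq0)).
exact: stem_factor.
Qed.

End StemsAndSignatures.

(** * Counting isomorphism classes *)

Section Counting.
Variables (k : closedFieldType) (p : nat).
Hypothesis (pchark : p \in [pchar k]).

Let TM (w : word) (w_even : ~~ odd (size w)) := tildeM pchark w_even.

Lemma card_rot_orbit (n : nat) (w : n.-tuple bool) :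
  #|[set y | fconnect (@rotT n) w y]| = order (@rotT n) w.
Proof. by rewrite cardsE. Qed.

Lemma order_rotT_connect (n : nat) (w y : n.-tuple bool) :
  fconnect (@rotT n) w y -> order (@rotT n) y = order (@rotT n) w.
Proof.
by move=> wy; apply/esym/eq_card => x; apply: (same_connect (fconnect_sym (@rotT_inj n))).
Qed.

Lemma order_rotT_star (n : nat) (w : n.-tuple bool) :
  order (@rotT n) (starT w) = order (@rotT n) w.
Proof.
have dvd (u : n.-tuple bool) : (order (@rotT n) (starT u) %| order (@rotT n) u)%N.
  by rewrite -(iter_id_order (@rotT_inj n)) -starT_iter iter_order //; exact: rotT_inj.
by apply/eqP; rewrite eqn_dvd dvd -{1}(starTK w) dvd.
Qed.

(** On primitive self-dual words of length q, isomorphism amounts to rotation, as the dual is itself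
    a rotation; each orbit has q elements. *)
Lemma has_card_Uni_Serre (h : nat) : (0 < h)%N -> ~~ odd h ->
  exists N : nat, has_card (Uni_Serre pchark (h, h)) N /\
  (N * h.*2)%:Z = \sum_(d <- divisors h.*2 | odd d) mobius d * 2 ^+ (h.*2 %/ (2 * d)).
Proof.
move=> h_gt0 h_even; set q := h.*2.
have q_gt0 : (0 < q)%N by rewrite double_gt0.
have even_q (w : q.-tuple bool) : ~~ odd (size w) by rewrite size_tuple odd_double.
rewrite -(card_primitive_self_dual (erefl q) q_gt0); set A := [set w | _].
have AE w : w \in A -> [/\ order (@rotT q) w = q & iter h (@rotT q) w = starT w].
  by rewrite inE => /andP[/eqP-> /eqP->].
have iso_rot (w : q.-tuple bool) i :
    bt_iso (odd i) (TM (even_q w)) (TM (even_q (iter i (@rotT q) w))).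
  move: (even_q (iter i _ w)); rewrite val_iter_rotT => ?; exact: tildeM_iter_rot.
(* Duality exchanges the parts, rotation by the even h does not, and both lead from w to its dual.
   Going there by one and back by the other exchanges the parts. *)
have iso_true (w : q.-tuple bool) : w \in A -> bt_iso true (TM (even_q w)) (TM (even_q w)).
  move=> /AE[_ wh]; have := iso_rot w h; rewrite wh (negPf h_even).
  move=> /bt_iso_sym/(bt_iso_trans (tildeM_star _ _ (even_q (starT w)))); exact.
have iso_q (x y : q.-tuple bool) : x \in A -> y \in A ->
    iso_class (TM (even_q x)) = iso_class (TM (even_q y)) <-> fconnect (@rotT q) x y.
  move=> xA yA; split=> [/eq_iso_class|/iter_findex <-].
    have x0 : (x : word) != [::] by rewrite -size_eq0 size_tuple -lt0n.
    have xy_size : size x = size y by rewrite !size_tuple.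
    move=> /(tildeM_iso_factor x0 xy_size)[j xy].
    rewrite fconnect_sym; last exact: rotT_inj.
    have [xE|xE] : x = iter j (@rotT q) y \/ x = iter (j + h) (@rotT q) y.
    - case: xy => xy; [left | right]; apply: val_inj;
        rewrite /= val_iter_rotT // iterD -val_iter_rotT.
      by have [_ ->] := AE _ yA.
    - by rewrite xE fconnect_iter.
    - by rewrite xE fconnect_iter.
  apply/eq_iso_class; have := iso_rot x (findex (@rotT q) x y).
  (* An odd rotation is corrected by the automorphism exchanging the parts. *)
  case: (odd _) => // xy; exact: bt_iso_trans (iso_true x xA) xy.
have [x xA|N [N_card <-]] := has_card_quotient q_gt0 iso_q.
  have [xq xh] := AE _ xA; rewrite -[RHS]xq -card_rot_orbit; apply: eq_card => y.
  rewrite !inE; have [xy|] := boolP (fconnect _ x y); rewrite ?andbF ?andbT //.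
  rewrite (order_rotT_connect xy) xq eqxx /=.
  by rewrite -(iter_findex xy) starT_iter -xh -!iterD addnC eqxx.
exists N; split=> //; suff -> : Uni_Serre pchark (h, h) =
  (fun C => exists2 x, x \in A & C = iso_class (TM (even_q x))) by [].
apply/funext => C; apply/propext.
split=> [[M [[w [w_even [w_prim w_dual w4 Mw]]] Ms ->]]|[x xA ->]].
  move/bt_iso_false in Mw.
  (* The signature alone forces the length 2h. *)
  have wh := tildeM_size_signature (has_signature_iso Mw Ms).
  have w_size : size w == q by apply/eqP.
  have wq : order (@rotT q) (Tuple w_size) = q by apply/primitive_wordE.
  exists (Tuple w_size); first by rewrite inE wq eqxx; apply/eqP/(self_dual_wordE (h := h)).
  by apply/eq_iso_class; rewrite (bool_irrelevance (even_q (Tuple w_size)) w_even).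
have [xq xh] := AE _ xA.
exists (TM (even_q x)); split=> //; last first.
  by apply: tildeM_signature; [exact: iso_true | rewrite size_tuple].
exists x, (even_q x); split.
- exact/primitive_wordE.
- exact/(self_dual_wordE (h := h)).
- by rewrite size_tuple /q -muln2 (@dvdn_pmul2r 2 2) // dvdn2.
- exact/bt_iso_false/bt_iso_refl.
Qed.

(** Rotation by the odd number m fixes zz, so the parts can be exchanged freely and isomorphism
    amounts to rotation and duality of z. The orbits of z and of its dual are disjoint, with m
    elements each. *)
Lemma has_card_Bi_Serre (m : nat) : odd m ->
  exists N : nat, has_card (Bi_Serre pchark (m, m)) N /\
  (N * m.*2)%:Z = \sum_(d <- divisors m) mobius d * 2 ^+ (m %/ d).
Proof.
move=> m_odd; have m_gt0 : (0 < m)%N by case: m m_odd.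
have even_q (z : m.-tuple bool) : ~~ odd (size (z ++ z)).
  by rewrite size_cat addnn odd_double.
rewrite -(card_primitive m_gt0); set A := [set w | _].
have AE z : z \in A -> order (@rotT m) z = m by rewrite inE => /eqP.
have iso_rot (z : m.-tuple bool) i :
    bt_iso (odd i) (TM (even_q z)) (TM (even_q (iter i (@rotT m) z))).
  move: (even_q (iter i _ z)); rewrite val_iter_rotT -iter_rot_cat => ?; exact: tildeM_iter_rot.
have iso_true (z : m.-tuple bool) : bt_iso true (TM (even_q z)) (TM (even_q z)).
  by have := iso_rot z m; rewrite iter_rotT_n m_odd.
have iso_odd c (x y : m.-tuple bool) : bt_iso c (TM (even_q x)) (TM (even_q y)) ->
    bt_iso false (TM (even_q x)) (TM (even_q y)).
  by case: c => // xy; exact: bt_iso_trans (iso_true x) xy.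
have iso_star (z : m.-tuple bool) : bt_iso false (TM (even_q z)) (TM (even_q (starT z))).
  apply: (iso_odd true); move: (even_q (starT z)).
  rewrite /= -map_cat => ?; exact: tildeM_star.
pose e := [rel x y | fconnect (@rotT m) x y || fconnect (@rotT m) (starT x) y].
have iso_e (x y : m.-tuple bool) : x \in A -> y \in A ->
    iso_class (TM (even_q x)) = iso_class (TM (even_q y)) <-> e x y.
  move=> xA yA; split=> [/eq_iso_class|/orP[]/iter_findex<-]; last first.
  - apply/eq_iso_class; apply: (@bt_iso_trans _ _ false false) (iso_star x) _.
    exact: iso_odd (iso_rot _ _).
  - apply/eq_iso_class; exact: iso_odd (iso_rot _ _).
  have x0 : x ++ x != [::] by rewrite -size_eq0 size_cat size_tuple addnn double_eq0 -lt0n.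
  have xy_size : size (x ++ x) = size (y ++ y) by rewrite !size_cat !size_tuple.
  move=> /(tildeM_iso_factor x0 xy_size)[j xy].
  rewrite /e /= fconnect_sym; last exact: rotT_inj.
  (* A rotation of yy is the square of the same rotation of y, so the first halves can be
     compared. *)
  have [->|xE] : x = iter j (@rotT m) y \/ x = iter j (@rotT m) (starT y).
  - case: xy => /eqP; rewrite /word_star ?map_cat iter_rot_cat;
      rewrite eqseq_cat ?size_iter_rot ?size_map ?size_tuple // => /andP[/eqP xy _];
      [left | right]; apply: val_inj; by rewrite /= val_iter_rotT.
  - by rewrite fconnect_iter.
  apply/orP; right; rewrite fconnect_sym; last exact: rotT_inj.
  have -> : starT x = iter j (@rotT m) y by rewrite xE starT_iter starTK.
  exact: fconnect_iter.
have m2_gt0 : (0 < m.*2)%N by rewrite double_gt0.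
have [x xA|N [N_card <-]] := has_card_quotient m2_gt0 iso_e.
  have xm := AE _ xA.
  have -> : [set y in A | e x y] =
            [set y | fconnect (@rotT m) x y] :|: [set y | fconnect (@rotT m) (starT x) y].
    apply/setP => y; rewrite !inE; have [exy|] := boolP (_ || _); rewrite ?andbF ?andbT //.
    case/orP: exy => /order_rotT_connect->; rewrite ?order_rotT_star xm eqxx //.
  rewrite cardsU !card_rot_orbit order_rotT_star xm addnn.
  suff -> : [set y | fconnect (@rotT m) x y] :&: [set y | fconnect (@rotT m) (starT x) y] = set0.
    by rewrite cards0 subn0.
  apply/setP => y; rewrite !inE; apply/negP => /andP[xy].
  rewrite fconnect_sym; last exact: rotT_inj.
  move=> /(connect_trans xy)/iter_findex => xs.
  (* A common element would make x self-dual, hence with as many f as v, against its odd length. *)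
  have : self_dual_word x by exists (findex (@rotT m) x (starT x)); rewrite -val_iter_rotT xs.
  case=> i /(congr1 (count id)).
  have perm : perm_eq (iter i (rot 1) x) x.
    by elim: (i) => //= j IH; rewrite perm_rot.
  rewrite (permP perm) count_map => cE.
  have := count_predC id x; rewrite size_tuple -cE => mE.
  by move: m_odd; rewrite -mE /= addnn odd_double.
exists N; split=> //; suff -> : Bi_Serre pchark (m, m) =
  (fun C => exists2 x, x \in A & C = iso_class (TM (even_q x))) by [].
apply/funext => C; apply/propext.
split=> [[M [[w [w_even [[z [wz z_prim z_odd]] Mw]]] Ms ->]]|[x xA ->]].
  move/bt_iso_false in Mw.
  have wh := tildeM_size_signature (has_signature_iso Mw Ms).
  have z_size : size z == m.
    by move: wh; rewrite wz size_cat addnn => /double_inj/eqP.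
  have zm : order (@rotT m) (Tuple z_size) = m by apply/primitive_wordE.
  exists (Tuple z_size); first by rewrite inE zm.
  apply/eq_iso_class; rewrite /TM; move: (even_q _) => /=; rewrite -wz => w_even'.
  by rewrite (bool_irrelevance w_even' w_even).
exists (TM (even_q x)); split=> //; last first.
  by apply: tildeM_signature; [exact: iso_true | rewrite size_cat size_tuple addnn].
exists (x ++ x), (even_q x); split; last exact/bt_iso_false/bt_iso_refl.
exists x; split=> //; last by rewrite size_tuple.
exact/primitive_wordE/AE.
Qed.

End Counting.

(** * From the integer identities to the rational formulas *)

Theorem propositionA19 (k : closedFieldType) (p : nat)
    (pchark : p \in [pchar k]) (p_gt2 : (2 < p)%N)
    (q : nat) (q_gt0 : (0 < q)%N) (q_even : ~~ odd q) :
  ((q %% 4)%N = 0%N ->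
    exists N : nat,
      has_card (Uni_Serre pchark (q %/ 2, q %/ 2)%N) N /\
      N%:Q = 1 / q%:Q *
        \sum_(d <- divisors q | odd d)
           (mobius d)%:~R * 2%:Q ^+ (q %/ (2 * d))) /\
  ((q %% 4)%N = 2%N ->
    exists N : nat,
      has_card (Bi_Serre pchark (q %/ 2, q %/ 2)%N) N /\
      N%:Q = 1 / q%:Q *
        \sum_(d <- divisors (q %/ 2))
           (mobius d)%:~R * 2%:Q ^+ (q %/ (2 * d))).
Proof.
have qE : q = (q %/ 2).*2 by lia.
move: (q %/ 2)%N qE => h qE; subst q.
have h_gt0 : (0 < h)%N by rewrite -double_gt0.
have divE (N : nat) (S : int) : (N * h.*2)%:Z = S -> N%:Q = 1 / h.*2%:Q * S%:~R.
  move=> <-; rewrite div1r PoszM intrM mulrCA mulVf ?mulr1 //.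
  by rewrite intr_eq0 eqz_nat -lt0n.
have sumE (r : seq nat) (P : pred nat) (E : nat -> nat) :
    (\sum_(d <- r | P d) mobius d * 2 ^+ E d)%:~R =
    \sum_(d <- r | P d) (mobius d)%:~R * 2%:Q ^+ E d.
  by rewrite rmorph_sum; apply: eq_bigr => d _; rewrite rmorphM rmorphXn.
split=> h4.
  have h_even : ~~ odd h by lia.
  have [N [N_card /divE NE]] := has_card_Uni_Serre pchark h_gt0 h_even.
  by exists N; rewrite -sumE.
have h_odd : odd h by lia.
have [N [N_card /divE NE]] := has_card_Bi_Serre pchark h_odd.
exists N; split=> //; rewrite NE -sumE; congr (_ * _%:~R).
by apply: eq_bigr => d _; rewrite -mul2n divnMl.
Qed.
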